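(* Let $\phi(z)=bz+cz^2+\int_{(0,\infty)}(e^{-zu}-1+zu)\,m(du)$ and $\psi(z)=\beta z+\int_{(0,\infty)}(1-e^{-zu})\,\nu(du)$ be branching and immigration mechanisms with $\int_{(0,\infty)}u\,\nu(du)<\infty$, and let $(P_t)_{t\ge 0}$ be the transition semigroup of the corresponding CBI-process. Suppose that there is some constant $\theta>0$ so that $$\phi(z)>0\ \text{ for } z\ge\theta\quad\text{and}\quad\int_\theta^\infty\phi(z)^{-1}\,dz<\infty .$$ Then for $t>0$ and $x,y\ge 0$ we have $$\|P_t(x,\cdot)-P_t(y,\cdot)\|_{\rm var}\le 2\big(1-e^{-\bar v_t|x-y|}\big)\le 2\bar v_t|x-y|,$$ where $\|\cdot\|_{\rm var}$ denotes the total variation norm.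
   Context: Mechanisms: $b\in\mathbb{R}$, $c\ge 0$, $m$ is a $\sigma$-finite measure on $(0,\infty)$ with $\int_{(0,\infty)}(u\wedge u^2)\,m(du)<\infty$; $\beta\ge 0$ and $\nu$ is a $\sigma$-finite measure on $(0,\infty)$ with $\int_{(0,\infty)}(1\wedge u)\,\nu(du)<\infty$. For $\lambda\ge 0$, $t\mapsto v_t(\lambda)$ is the unique nonnegative solution of $v_t(\lambda)=\lambda-\int_0^t\phi(v_s(\lambda))\,ds$. The transition semigroup of the CBI-process is given by $\int_{[0,\infty)}e^{-\lambda y}P_t(x,dy)=\exp\{-xv_t(\lambda)-\int_0^t\psi(v_s(\lambda))\,ds\}$, $\lambda\ge 0$. $\bar v_t=\lim_{\lambda\to\infty}v_t(\lambda)$ (an increasing limit), which is finite for $t>0$ under the stated integral condition; equivalently $t\mapsto\bar v_t$ is the unique solution of $\frac{d}{dt}\bar v_t=-\phi(\bar v_t)$, $t>0$, with $\bar v_{0+}=\infty$. The total variation norm of a signed measure $\mu$ is $\sup_f|\int f\,d\mu|$ over Borel $f$ on $[0,\infty)$ with $\sup|f|\le 1$. *)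

(* Defs.v *)
From HB Require Import structures.
From mathcomp Require Import all_boot all_order all_algebra.
From mathcomp Require Import all_classical all_reals all_analysis.
Set Implicit Arguments.
Unset Strict Implicit.
Unset Printing Implicit Defensive.
Import Order.TTheory GRing.Theory Num.Theory.
Import numFieldNormedType.Exports.
Local Open Scope classical_set_scope.
Local Open Scope ring_scope.

(* Measures on (0, +oo) and on [0, +oo) are represented by Borel measures on R
   that are only ever integrated over `]0, +oo[, resp. are concentrated on
   `[0, +oo[. *)

Definition branching_mechanism (R : realType) (b c : R)
    (m : {measure set (measurableTypeR R) -> \bar R}) (z : R) : R :=
  b * z + c * z ^+ 2
  + \int[m]_(u in `]0, +oo[) (expR (- (z * u)) - 1 + z * u).

Definition immigration_mechanism (R : realType) (beta : R)
    (nu : {measure set (measurableTypeR R) -> \bar R}) (z : R) : R :=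
  beta * z + \int[nu]_(u in `]0, +oo[) (1 - expR (- (z * u))).

(* w is a nonnegative solution on [0, +oo[ of
     w t = lambda - \int_0^t phi (w s) ds.
   Integrability is part of being a solution: Rintegral is total and takes a
   default value on non-integrable functions. *)
Definition cumulant_solution (R : realType) (phi : R -> R) (lambda : R)
    (w : R -> R) : Prop :=
  forall t : R, 0 <= t ->
    [/\ 0 <= w t,
        (@lebesgue_measure R).-integrable `[0, t]%classic (fun s => (phi (w s))%:E) &
        w t = lambda - \int[@lebesgue_measure R]_(s in `[0, t]) phi (w s)].

(* Markov semigroup on the state space [0, +oo[.  The kernels are total on R;
   their values at negative times or starting points are irrelevant. *)
Record transition_semigroup (R : realType)
    (P : R -> R.-pker (measurableTypeR R) ~> (measurableTypeR R)) : Prop := {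
  semigroup_state_space : forall t x : R, 0 <= t -> 0 <= x ->
    P t x `[0, +oo[%classic = 1%E;
  semigroup0 : forall (x : R) (A : set (measurableTypeR R)),
    0 <= x -> measurable A -> P 0 x A = \d_x A;
  semigroupD : forall (s t x : R) (A : set (measurableTypeR R)),
    0 <= s -> 0 <= t -> 0 <= x -> measurable A ->
    P (s + t) x A = (\int[P s x]_(y in `[0%R, +oo[) P t y A)%E }.

(* v t lambda stands for v_t(lambda). *)
Definition cbi_transition_semigroup (R : realType) (psi : R -> R)
    (v : R -> R -> R)
    (P : R -> R.-pker (measurableTypeR R) ~> (measurableTypeR R)) : Prop :=
  transition_semigroup P /\
  forall t x lambda : R, 0 <= t -> 0 <= x -> 0 <= lambda ->
    \int[P t x]_(y in `[0, +oo[) expR (- (lambda * y))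
    = expR (- (x * v t lambda)
            - \int[@lebesgue_measure R]_(s in `[0, t]) psi (v s lambda)).

Definition vbar (R : realType) (v : R -> R -> R) (t : R) : R :=
  lim (v t lambda @[lambda --> +oo]).

(* Total variation norm of the signed measure mu - nu, for finite measures mu
   and nu on [0, +oo[; the integral against mu - nu is the difference of the
   integrals.  With this normalization, the norm of a difference of two
   mutually singular probability measures is 2. *)
Definition var_norm_sub (R : realType)
    (mu nu : {measure set (measurableTypeR R) -> \bar R}) : \bar R :=
  ereal_sup [set (`| \int[mu]_(u in `[0, +oo[) f u
                     - \int[nu]_(u in `[0, +oo[) f u |)%:E
            | f in [set f : measurableTypeR R -> R |
                measurable_fun (`[0, +oo[%classic : set (measurableTypeR R)) f /\
                (forall u : R, 0 <= u -> `|f u| <= 1)]].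

(* Main.v *)
(* For x >= y, P_t(x, .) dominates a P_t(y, .) with a = exp (- vbar_t (x - y)),
   and domination of one probability measure by a times another bounds the total
   variation distance by 2 (1 - a).  The domination is read off the Laplace
   transforms at the integers k: the difference of the two is
     L_y(k) a (exp ((x - y) (vbar_t - v_t(k))) - 1),
   a completely monotone sequence as soon as k |-> v_t(k) is a Bernstein sequence
   (nonnegative with completely monotone increments).  By Hausdorff's argument
   (Bernstein polynomials in e^{-u}) complete monotonicity of the transform of a
   signed measure implies its positivity.  That v_t is Bernstein follows from the
   explicit Euler scheme z |-> z - d phi(z): once phi is approximated by A z - h(z)
   with h a Bernstein function, each step with d A <= 1 preserves Bernstein
   sequences.  Finally vbar_t is finite because int 1/phi over [w_s, w_0] equals s
   along a solution w staying above theta. *)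
Require Import Defs.
From HB Require Import structures.
From mathcomp Require Import all_boot all_order all_algebra.
From mathcomp Require Import all_classical all_reals all_analysis.
From mathcomp Require Import measurable_realfun ring lra.
Set Implicit Arguments.
Unset Strict Implicit.
Unset Printing Implicit Defensive.
Import Order.TTheory GRing.Theory Num.Theory.
Import numFieldNormedType.Exports.
Local Open Scope classical_set_scope.
Local Open Scope ring_scope.

(** * Completely monotone and Bernstein sequences *)

(** The predicate says that the iterated backward differences of orders 0 to [n] are nonnegative;
    complete monotonicity proper is [forall n, cm n a]. Keeping the order finite allows induction on
    it. *)
Fixpoint completely_monotone {R : realType} n (a : nat -> R) : Prop :=
  match n with
  | 0 => forall k, 0 <= a k
  | n'.+1 => completely_monotone n' a
             /\ completely_monotone n' (fun k => a k - a k.+1)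
  end.
Notation cm := completely_monotone.

Section monotone_sequences.
Context {R : realType}.
Implicit Types (a b w : nat -> R) (n k : nat).

Lemma cm_ge0 n a : cm n a -> forall k, 0 <= a k.
Proof. by elim: n a => [//|n IH] a [/IH]. Qed.

Lemma eq_cm n a b : a =1 b -> cm n a -> cm n b.
Proof. by move/funext ->. Qed.

Lemma cm_shift n a : cm n a -> cm n (fun k => a k.+1).
Proof.
by elim: n a => [|n IH] a; [move=> h k; exact: h | case=> /IH ? /IH ?; split].
Qed.

Lemma cmD n a b : cm n a -> cm n b -> cm n (fun k => a k + b k).
Proof.
elim: n a b => [|n IH] a b; first by move=> ha hb k; rewrite addr_ge0.
case=> a1 a2 [b1 b2]; split; first exact: IH.
by apply: eq_cm (IH _ _ a2 b2) => k; ring.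
Qed.

Lemma cm_cst n (x : R) : 0 <= x -> cm n (fun=> x).
Proof.
elim: n x => [x x0 k //|n IH x x0]; split; first exact: IH.
by rewrite subrr; exact: IH.
Qed.

(** Discrete Leibniz rule: the backward difference of [a * b] at [k] is [(a k - a k.+1) * b k + a
    k.+1 * (b k - b k.+1)], a sum of products of sequences that are [cm] of one order less. *)
Lemma cmM n a b : cm n a -> cm n b -> cm n (fun k => a k * b k).
Proof.
elim: n a b => [|n IH] a b; first by move=> ha hb k; rewrite mulr_ge0.
case=> a1 a2 [b1 b2]; split; first exact: IH.
apply: eq_cm (cmD (IH _ _ a2 b1) (IH _ _ (cm_shift a1) b2)) => k; ring.
Qed.

Lemma cmZ n (x : R) a : 0 <= x -> cm n a -> cm n (fun k => x * a k).
Proof. by move=> x0; apply: cmM; exact: cm_cst. Qed.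

Lemma cmX n a i : cm n a -> cm n (fun k => a k ^+ i).
Proof.
move=> ha; elim: i => [|i IH]; first by apply: eq_cm (cm_cst n ler01) => k.
by apply: eq_cm (cmM ha IH) => k; rewrite exprS.
Qed.

Lemma cm_sum n (I : Type) (r : seq I) (F : I -> nat -> R) :
  (forall i, cm n (F i)) -> cm n (fun k => \sum_(i <- r) F i k).
Proof.
move=> hF; elim: r => [|i r IH].
  by apply: eq_cm (cm_cst n (lexx 0)) => k; rewrite big_nil.
by apply: eq_cm (cmD (hF i) IH) => k; rewrite big_cons.
Qed.

Lemma cm_lim n (a_ : nat -> nat -> R) a : (forall i, cm n (a_ i)) ->
  (forall k, a_ i k @[i --> \oo] --> a k) -> cm n a.
Proof.
elim: n a_ a => [|n IH] a_ a ha cva.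
  by move=> k; apply: (cvgr_to_ge (cva k)); apply: nearW => i; exact: ha.
split; first by apply: IH cva => i; case: (ha i).
apply: (IH (fun i k => a_ i k - a_ i k.+1)) => [i|k]; first by case: (ha i).
exact: cvgB.
Qed.

Lemma cm_Rintegral d (T : measurableType d) (mu : {measure set T -> \bar R})
    (D : set T) n (F : T -> nat -> R) : measurable D ->
  (forall k, mu.-integrable D (fun x => (F x k)%:E)) ->
  (forall x, D x -> cm n (F x)) ->
  cm n (fun k => \int[mu]_(x in D) F x k).
Proof.
move=> mD; elim: n F => [|n IH] F iF hF.
  by move=> k; apply: Rintegral_ge0 => x /hF; exact.
split; first by apply: IH => // x /hF[].
apply: eq_cm (IH (fun x k => F x k - F x k.+1) _ _) => [k||x /hF[]//].
  by rewrite RintegralB//; exact: iF.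
by move=> k; apply: eq_integrable (integrableB mD (iF k) (iF k.+1)).
Qed.

(** The exponential series without its constant term has nonnegative coefficients, so its partial
    sums inherit [cm n] from the powers of [a]. *)
Lemma cm_expR_sub1 n a : cm n a -> cm n (fun k => expR (a k) - 1).
Proof.
move=> ha.
apply: (@cm_lim _ (fun N k => \sum_(0 <= i < N) a k ^+ i.+1 / (i.+1)`!%:R)).
  move=> N; apply: cm_sum => i.
  apply: eq_cm (cmZ _ (cmX i.+1 ha)) => [k|]; first exact: mulrC.
  by rewrite invr_ge0.
move=> k.
have cv : series (exp_coeff (a k)) N.+1 @[N --> \oo] --> expR (a k).
  by rewrite cvg_shiftS; exact: is_cvg_series_exp_coeff.
apply: cvg_trans (cvgB cv (cvg_cst (1 : R))); apply: near_eq_cvg; apply: nearW => N.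
rewrite /series /= !fctE.
by rewrite big_nat_recl//= /exp_coeff /= expr0 fact0 divr1 addrAC subrr add0r.
Qed.

Definition bernstein w :=
  (forall k, 0 <= w k) /\ forall n, cm n (fun k => w k.+1 - w k).

Lemma eq_bernstein w1 w2 : w1 =1 w2 -> bernstein w1 -> bernstein w2.
Proof. by move/funext ->. Qed.

Lemma bernstein_nd w k : bernstein w -> w k <= w k.+1.
Proof. by move=> [_ /(_ 0)/(_ k)]; rewrite subr_ge0. Qed.

Lemma bernsteinD w1 w2 : bernstein w1 -> bernstein w2 ->
  bernstein (fun k => w1 k + w2 k).
Proof.
move=> [p1 c1] [p2 c2]; split=> [k|n]; first exact: addr_ge0.
by apply: eq_cm (cmD (c1 n) (c2 n)) => k; ring.
Qed.

Lemma bernsteinZ (x : R) w : 0 <= x -> bernstein w ->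
  bernstein (fun k => x * w k).
Proof.
move=> x0 [p c]; split=> [k|n]; first exact: mulr_ge0.
by apply: eq_cm (cmZ x0 (c n)) => k; ring.
Qed.

Lemma bernstein_lim (w_ : nat -> nat -> R) w : (forall i, bernstein (w_ i)) ->
  (forall k, w_ i k @[i --> \oo] --> w k) -> bernstein w.
Proof.
move=> hw cvw; split.
  by apply: (@cm_lim 0) cvw => i; case: (hw i).
move=> n; apply: (@cm_lim _ (fun i k => w_ i k.+1 - w_ i k)) => [i|k].
  by case: (hw i).
exact: cvgB.
Qed.

(* With [d] the increments of [w], the backward difference of [exp (- u w)] is
   [exp (- u w (k+1)) * (exp (u d) - 1)]: induction on the order. *)
Lemma cm_expRN_bernstein (u : R) w n : 0 <= u -> bernstein w ->
  cm n (fun k => expR (- (u * w k))).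
Proof.
move=> u0 [w0 cw]; elim: n => [|n IH]; first by move=> k; exact: expR_ge0.
split=> //.
apply: eq_cm (cmM (cm_shift IH) (cm_expR_sub1 (cmZ u0 (cw n)))) => k.
by rewrite mulrBr mulr1 -expRD; congr (expR _ - _); ring.
Qed.

(** The increments are the backward differences of the completely monotone sequence
    [expR (- (u * w k))]. *)
Lemma bernstein_1subexpRN (u : R) w : 0 <= u -> bernstein w ->
  bernstein (fun k => 1 - expR (- (u * w k))).
Proof.
move=> u0 bw; split=> [k|n].
  by rewrite subr_ge0 expR_le1 oppr_le0 mulr_ge0//; case: bw.
by have [_] := cm_expRN_bernstein n.+1 u0 bw; apply: eq_cm => k; ring.
Qed.

Lemma bernstein_Rintegral d (T : measurableType d)
    (mu : {measure set T -> \bar R}) (D : set T) (F : T -> nat -> R) :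
  measurable D -> (forall k, mu.-integrable D (fun x => (F x k)%:E)) ->
  (forall x, D x -> bernstein (F x)) ->
  bernstein (fun k => \int[mu]_(x in D) F x k).
Proof.
move=> mD iF hF; split=> [k|n].
  by apply: Rintegral_ge0 => x /hF[].
apply: eq_cm (@cm_Rintegral _ _ mu D n (fun x k => F x k.+1 - F x k) mD _ _).
- by move=> k; rewrite RintegralB//; exact: iF.
- by move=> k; apply: eq_integrable (integrableB mD (iF k.+1) (iF k)).
- by move=> x /hF[].
Qed.

Lemma bernstein_affine (x h : R) : 0 <= x -> 0 <= h ->
  bernstein (fun k => x + h * k%:R).
Proof.
move=> x0 h0; split=> [k|n]; first by rewrite addr_ge0// mulr_ge0.
by apply: eq_cm (cm_cst n h0) => k; rewrite -natr1; ring.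
Qed.

End monotone_sequences.

(** * Bounds on the Levy kernel *)

Section kernel_bounds.
Context {R : realType}.
Implicit Types x z u : R.

Lemma expRN_ge1B x : 1 - x <= expR (- x).
Proof. exact: expR_ge1Dx. Qed.

Lemma expR_ge_quadratic x : 0 <= x -> 1 + x + x ^+ 2 / 2 <= expR x.
Proof.
move=> x0; have -> : 1 + x + x ^+ 2 / 2 = series (exp_coeff x) 3.
  by rewrite /series /= !big_nat_recr//= big_geq// /exp_coeff /= add0r
    (_ : 2`! = 2)%N// (_ : 1`! = 1)%N// fact0 expr0 expr1 !divr1.
apply: (@nondecreasing_cvgn_le _ (series (exp_coeff x))).
  by apply: nondecreasing_series => n _ _; rewrite /exp_coeff /= divr_ge0 ?exprn_ge0.
exact: is_cvg_series_exp_coeff.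
Qed.

(** Follows from the lower bound on [expR x], because [(1 - x + x^2/2) * (1 + x + x^2/2) = 1 + x^4/4
    >= 1]. *)
Lemma expRN_le_quadratic x : 0 <= x -> expR (- x) <= 1 - x + x ^+ 2 / 2.
Proof.
move=> x0; have h := expR_ge_quadratic x0.
rewrite expRN -[leLHS]mul1r ler_pdivrMr ?expR_gt0//.
have q0 : 0 <= 1 - x + x ^+ 2 / 2 by nra.
apply: le_trans (ler_wpM2l q0 h).
have : 0 <= x ^+ 4 by rewrite exprn_ge0.
have -> : (1 - x + x ^+ 2 / 2) * (1 + x + x ^+ 2 / 2) = 1 + x ^+ 4 / 4 by field.
lra.
Qed.

(** The difference of the two sides vanishes at 0, and its derivative is nonnegative by
    [expRN_le_quadratic]; the mean value theorem concludes. *)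
Lemma expRN_ge_cubic x : 0 <= x -> 1 - x + x ^+ 2 / 2 - x ^+ 3 / 6 <= expR (- x).
Proof.
move=> x0.
pose f : R -> R := (expR \o -%R) - cst 1 + id - 2^-1 *: (id ^+ 2) + 6^-1 *: (id ^+ 3).
have fE (y : R) : f y = expR (- y) - 1 + y - y ^+ 2 / 2 + y ^+ 3 / 6.
  by rewrite /f !fctE /GRing.scale /=; field.
pose df (y : R) := - expR (- y) + 1 - y + y ^+ 2 / 2.
have dfE (y : R) : is_derive y 1 f (df y).
  have h : is_derive y 1 (expR \o -%R) (expR (- y) * -1).
    by apply: is_derive1_comp.
  have h2 : is_derive y 1 (id ^+ 2 : R -> R) _ := is_deriveX 2 (is_derive_id y 1).
  have h3 : is_derive y 1 (id ^+ 3 : R -> R) _ := is_deriveX 3 (is_derive_id y 1).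
  have := is_deriveD (is_deriveB (is_deriveD (is_deriveB h (is_derive_cst (1 : R) y 1))
    (is_derive_id y 1)) (is_deriveZ 2^-1 h2)) (is_deriveZ 6^-1 h3).
  move/is_derive_eq; apply.
  by rewrite /df /GRing.scale /= /GRing.scale /=; field.
have [c] : exists2 c, c \in `[0, x] & f x - f 0 = df c * (x - 0).
  apply: MVT_segment => //.
  apply: derivable_within_continuous => y _; exact: ex_derive.
rewrite in_itv/= => /andP[c0 _].
rewrite subr0 !fE oppr0 expR0 !expr0n/= => E.
have : 0 <= df c * x by rewrite mulr_ge0// /df; have := expRN_le_quadratic c0; lra.
rewrite -E; lra.
Qed.

Definition levy_kernel z u : R := expR (- (z * u)) - 1 + z * u.

Lemma levy_kernel_ge0 z u : 0 <= levy_kernel z u.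
Proof. by rewrite /levy_kernel; have := expRN_ge1B (z * u); lra. Qed.

Lemma le_mul_min x y u v : 0 <= x -> y <= x * u -> y <= x * v ->
  y <= x * Num.min u v.
Proof. by move=> x0 h1 h2; rewrite minr_pMr// le_min h1. Qed.

Lemma levy_kernel_le z u : 0 <= z -> 0 <= u ->
  levy_kernel z u <= (z + z ^+ 2) * Num.min u (u ^+ 2).
Proof.
move=> z0 u0; have zu0 : 0 <= z * u by rewrite mulr_ge0.
rewrite /levy_kernel; apply: le_mul_min; first by rewrite addr_ge0 ?exprn_ge0.
  have : expR (- (z * u)) <= 1 by rewrite expR_le1 oppr_le0.
  have : 0 <= z ^+ 2 * u by rewrite mulr_ge0 ?exprn_ge0.
  lra.
have := expRN_le_quadratic zu0.
have : 0 <= z * u ^+ 2 by rewrite mulr_ge0 ?exprn_ge0.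
have : 0 <= z ^+ 2 * u ^+ 2 by rewrite mulr_ge0 ?exprn_ge0.
rewrite exprMn; lra.
Qed.

Lemma levy_kernel_nd y z u : 0 <= y -> y <= z -> 0 <= u ->
  levy_kernel y u <= levy_kernel z u.
Proof.
move=> y0 yz u0.
have d0 : 0 <= (z - y) * u by rewrite mulr_ge0// subr_ge0.
have yu0 : 0 <= y * u by rewrite mulr_ge0.
have E : expR (- (z * u)) = expR (- (y * u)) * expR (- ((z - y) * u)).
  by rewrite -expRD; congr expR; ring.
have e1 : expR (- (y * u)) <= 1 by rewrite expR_le1 oppr_le0.
have e0 := expR_ge0 (- (y * u)).
have := expRN_ge1B ((z - y) * u).
rewrite /levy_kernel E; nra.
Qed.

(** The kernel is convex in [z] with derivative [u * (1 - expR (- (z * u)))], so the increment is at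
    most [z - y] times the derivative at [z]. That derivative is at most both [u] and [z * u^2]. *)
Lemma levy_kernel_lipschitz y z u : 0 <= y -> y <= z -> 0 <= u ->
  levy_kernel z u - levy_kernel y u
    <= (z - y) * (1 + z) * Num.min u (u ^+ 2).
Proof.
move=> y0 yz u0; have z0 := le_trans y0 yz.
have zu0 : 0 <= z * u by rewrite mulr_ge0.
have d0 : 0 <= (z - y) * u by rewrite mulr_ge0// subr_ge0.
have E : expR (- (y * u)) = expR (- (z * u)) * expR ((z - y) * u).
  by rewrite -expRD; congr expR; ring.
have e0 := expR_ge0 (- (z * u)).
have h : levy_kernel z u - levy_kernel y u
         <= (z - y) * u * (1 - expR (- (z * u))).
  have := expR_ge1Dx ((z - y) * u).
  rewrite /levy_kernel E; nra.
have h1 : 1 - expR (- (z * u)) <= 1 by lra.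
have h2 : 1 - expR (- (z * u)) <= z * u.
  by have := expRN_ge1B (z * u); lra.
apply: (le_trans h); apply: le_mul_min.
- by rewrite mulr_ge0 ?subr_ge0// addr_ge0.
- apply: (le_trans (ler_wpM2l d0 h1)).
  have := mulr_ge0 d0 z0; lra.
- apply: (le_trans (ler_wpM2l d0 h2)).
  have := mulr_ge0 d0 u0; rewrite expr2; lra.
Qed.

(** Jumps of size [p^-1] at rate [2 * p^2] imitate the diffusion term [z^2]. After the substitution
    [x = z / p], the error is controlled by the Taylor bounds of orders 2 and 3. *)
Lemma levy_kernel_quadratic z (p : R) : 0 <= z -> 0 < p ->
  `|z ^+ 2 - 2 * p ^+ 2 * levy_kernel z p^-1| <= z ^+ 3 / p.
Proof.
move=> z0 p0; set x := z / p; have x0 : 0 <= x by rewrite divr_ge0// ltW.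
have zE : z = x * p by rewrite /x divfK// gt_eqF.
have h1 := expRN_le_quadratic x0; have h2 := expRN_ge_cubic x0.
have p2 : 0 <= p ^+ 2 by rewrite exprn_ge0// ltW.
have x3 : 0 <= x ^+ 3 by rewrite exprn_ge0.
have -> : z ^+ 3 / p = p ^+ 2 * x ^+ 3 by rewrite zE; field; rewrite gt_eqF.
have -> : z ^+ 2 - 2 * p ^+ 2 * levy_kernel z p^-1
          = p ^+ 2 * (x ^+ 2 - 2 * (expR (- x) - 1 + x)).
  by rewrite /levy_kernel -/x zE; ring.
rewrite normrM ger0_norm// ler_wpM2l// ler_norml; apply/andP; split; lra.
Qed.

End kernel_bounds.

(** * The branching mechanism and its approximations *)

Section branching_approximation.
Context {R : realType} (b c : R) (m : {measure set (measurableTypeR R) -> \bar R}).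
Hypotheses (hc : 0 <= c)
  (hm : (\int[m]_(u in `]0%R, +oo[) (Num.min u (u ^+ 2))%:E < +oo)%E).
Implicit Types (p y z K : R).

Let D : set (measurableTypeR R) := `]0, +oo[%classic.
Let mn (u : measurableTypeR R) : R := Num.min u (u ^+ 2).
Let phi := branching_mechanism b c m.
Let M := \int[m]_(u in D) mn u.

Let mD : measurable D. Proof. exact: measurable_itv. Qed.

Lemma measurable_levy_kernel z (E : set (measurableTypeR R)) :
  measurable_fun E (levy_kernel z : measurableTypeR R -> R).
Proof.
apply: measurable_funD; last exact: mulrl_measurable.
apply: measurable_funB => //.
apply: (measurableT_comp (@measurable_expR R)).
by apply: measurable_funN; exact: mulrl_measurable.
Qed.

Let mmn (E : set (measurableTypeR R)) : measurable_fun E mn.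
Proof.
by apply: measurable_minr; [exact: measurable_id | exact: exprn_measurable].
Qed.

Let mn_ge0 u : 0 <= u -> 0 <= mn u.
Proof. by move=> u0; rewrite le_min u0 exprn_ge0. Qed.

Let D_ge0 u : D u -> 0 <= u.
Proof. by rewrite /D /= in_itv/= andbT => /ltW. Qed.

Let imn : m.-integrable D (EFin \o mn).
Proof.
apply/integrableP; split; first by apply/measurable_EFinP; exact: mmn.
rewrite (eq_integral (EFin \o mn)); first exact: hm.
move=> u /set_mem /D_ge0 u0.
by rewrite /= ger0_norm// mn_ge0.
Qed.

Let M0 : 0 <= M.
Proof. by apply: Rintegral_ge0 => u /D_ge0 /mn_ge0. Qed.

Lemma integrable_levy_kernel z (E : set (measurableTypeR R)) :
  0 <= z -> measurable E -> E `<=` D ->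
  m.-integrable E (EFin \o levy_kernel z).
Proof.
move=> z0 mE ED; apply: (integrableS mD mE ED).
apply: le_integrable (integrableZl mD (z + z ^+ 2) imn) => //.
  by apply/measurable_EFinP; exact: measurable_levy_kernel.
move=> u /D_ge0 u0; rewrite /= lee_fin ger0_norm ?levy_kernel_ge0//.
rewrite ger0_norm ?levy_kernel_le//.
by rewrite mulr_ge0 ?mn_ge0// addr_ge0 ?exprn_ge0.
Qed.

(** The three summands bound, on [[0, K]], the derivatives of the linear, quadratic and jump terms
    of [phi]. *)
Definition branching_lipschitz_const K := `|b| + 2 * c * K + (1 + K) * M.

Lemma branching_lipschitz K y z : 0 <= y <= K -> 0 <= z <= K ->
  `|phi z - phi y| <= branching_lipschitz_const K * `|z - y|.
Proof.
wlog yz : y z / y <= z => [wl hy hz|].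
  by case: (leP y z) => [|/ltW] ?; [|rewrite distrC (distrC z)]; apply: wl.
move=> /andP[y0 _] /andP[z0 zK].
have iz := integrable_levy_kernel z0 mD (@subset_refl _ _).
have iy := integrable_levy_kernel y0 mD (@subset_refl _ _).
set L := branching_lipschitz_const K.
have -> : phi z - phi y = b * (z - y) + c * (z ^+ 2 - y ^+ 2)
    + \int[m]_(u in D) (levy_kernel z u - levy_kernel y u).
  by rewrite RintegralB// /phi /branching_mechanism -/D; ring.
set I := \int[m]_(u in D) _.
have I0 : 0 <= I.
  by apply: Rintegral_ge0 => u /D_ge0 u0; rewrite subr_ge0 levy_kernel_nd.
have I1 : I <= (z - y) * (1 + z) * M.
  rewrite -RintegralZl//; apply: le_Rintegral => //.
  - by apply: eq_integrable (integrableB mD iz iy).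
  - by apply: eq_integrable (integrableZl mD _ imn).
  - by move=> u /D_ge0 u0; exact: levy_kernel_lipschitz.
have zy0 : 0 <= z - y by rewrite subr_ge0.
rewrite (ger0_norm zy0) /L /branching_lipschitz_const.
have h1 : `|b * (z - y)| = `|b| * (z - y) by rewrite normrM (ger0_norm zy0).
have h2 : 0 <= c * (z ^+ 2 - y ^+ 2).
  by rewrite mulr_ge0// subr_sqr mulr_ge0// addr_ge0.
have h3 : c * (z ^+ 2 - y ^+ 2) <= 2 * c * K * (z - y).
  rewrite subr_sqr (mulrC (z - y)) mulrA ler_wpM2r// -mulrA mulrCA ler_wpM2l//.
  lra.
have h4 : (z - y) * (1 + z) * M <= (1 + K) * M * (z - y).
  by rewrite mulrC mulrA mulrAC ler_wpM2r// mulrC ler_wpM2r// lerD2l.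
apply: (le_trans (ler_normD _ _)); rewrite (ger0_norm I0).
apply: (le_trans (lerD (ler_normD _ _) (lexx _))); rewrite (ger0_norm h2) h1.
lra.
Qed.

Lemma branching_bounded K y : 0 <= y <= K ->
  `|phi y| <= branching_lipschitz_const K * K + `|phi 0|.
Proof.
move=> yK; have /andP[y0 yK1] := yK.
have h00 : 0 <= (0 : R) <= K by rewrite lexx (le_trans y0).
have -> : phi y = (phi y - phi 0) + phi 0 by rewrite subrK.
apply: (le_trans (ler_normD _ _)); rewrite lerD2r.
apply: (le_trans (branching_lipschitz h00 yK)).
rewrite subr0 ger0_norm// ler_wpM2l// /branching_lipschitz_const.
by rewrite !addr_ge0 ?mulr_ge0 ?addr_ge0// (le_trans y0).
Qed.

Lemma branching_continuous z : 0 < z -> {for z, continuous phi}.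
Proof.
move=> z0; apply/cvgrPdist_le => e e0.
pose L := branching_lipschitz_const (z + 1).
have L0 : 0 <= L.
  by rewrite /L /branching_lipschitz_const !addr_ge0 ?mulr_ge0 ?addr_ge0// ltW.
near=> y.
have yz : 0 <= y <= z + 1.
  have : `|z - y| <= Num.min z 1.
    by near: y; apply: cvgr_dist_le; [exact: cvg_id | rewrite lt_min z0 ltr01].
  rewrite le_min !ler_norml => /andP[/andP[_ ?] /andP[? _]].
  by apply/andP; split; lra.
have zz : 0 <= z <= z + 1 by rewrite ltW//= lerDl.
apply: (le_trans (branching_lipschitz yz zz)).
(* [L] may be zero, so the division below is by [L + 1]. *)
apply: (@le_trans _ _ ((L + 1) * `|z - y|)).
  by rewrite ler_wpM2r// lerDl.
rewrite mulrC -ler_pdivlMr; last by rewrite ltr_wpDl.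
by near: y; apply: cvgr_dist_le; [exact: cvg_id | rewrite divr_gt0 ?ltr_wpDl].
Unshelve. all: by end_near. Qed.

(* Diffusion is replaced by jumps of size [p^-1], and the jumps of size at most
   [p^-1] are dropped, so that [z] enters linearly up to a Bernstein function. *)
Definition branching_approx p z :=
  b * z + c * (2 * p ^+ 2 * levy_kernel z p^-1)
  + \int[m]_(u in `]p^-1, +oo[) levy_kernel z u.

Definition small_jumps p := \int[m]_(u in `]0, p^-1]) mn u.

Let big_sub p : 0 < p -> `]p^-1, +oo[%classic `<=` D.
Proof. by move=> p0; apply: subset_itvr; rewrite bnd_simp invr_ge0 ltW. Qed.

Let small_sub p : `]0, p^-1]%classic `<=` D.
Proof. exact: subset_itvl. Qed.

(** The diffusion and jump terms are nonnegative. This linear lower bound, uniform in [p], is what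
    keeps the growth of the Euler iterates exponential. *)
Lemma branching_approx_ge p z : 0 < p -> 0 <= z -> b * z <= branching_approx p z.
Proof.
move=> p0 z0; rewrite /branching_approx -addrA lerDl addr_ge0//.
  by rewrite !mulr_ge0// ?levy_kernel_ge0// ltW.
by apply: Rintegral_ge0 => u _; exact: levy_kernel_ge0.
Qed.

Let Rintegral_jumps p (f : measurableTypeR R -> R) : 0 < p ->
  m.-integrable D (EFin \o f) ->
  \int[m]_(u in D) f u = \int[m]_(u in `]0, p^-1]) f u
                         + \int[m]_(u in `]p^-1, +oo[) f u.
Proof.
move=> p0 iF.
have E : D = `]0, p^-1]%classic `|` `]p^-1, +oo[%classic.
  by rewrite -itv_bndbnd_setU// ?bnd_simp// invr_ge0 ltW.
rewrite E Rintegral_setU//; first by rewrite -E.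
apply/disj_setPS => u [/=]; rewrite !in_itv/= => /andP[_ up] /andP[].
by rewrite ltNge up.
Qed.

Lemma branching_approx_dist p z : 0 < p -> 0 <= z ->
  `|phi z - branching_approx p z|
    <= c * (z ^+ 3 / p) + (z + z ^+ 2) * small_jumps p.
Proof.
move=> p0 z0.
have iz := integrable_levy_kernel z0 mD (@subset_refl _ _).
have sE := Rintegral_jumps p0 iz.
have -> : phi z - branching_approx p z
    = c * (z ^+ 2 - 2 * p ^+ 2 * levy_kernel z p^-1)
      + \int[m]_(u in `]0, p^-1]) levy_kernel z u.
  by rewrite /phi /branching_mechanism -/(levy_kernel z _) sE /branching_approx; ring.
apply: (le_trans (ler_normD _ _)); apply: lerD.
  by rewrite normrM ger0_norm// ler_wpM2l// levy_kernel_quadratic.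
have ms : measurable (`]0, p^-1]%classic : set (measurableTypeR R)).
  exact: measurable_itv.
have is_ := integrableS mD ms (@small_sub p) imn.
rewrite ger0_norm; last by apply: Rintegral_ge0 => u _; exact: levy_kernel_ge0.
rewrite -RintegralZl//; apply: le_Rintegral => //.
- exact: integrable_levy_kernel.
- by apply: eq_integrable (integrableZl ms _ is_).
- by move=> u /small_sub /D_ge0 u0; exact: levy_kernel_le.
Qed.

(** Dominated convergence under the integrable function [mn]: every fixed [u > 0] eventually exceeds
    [n.+1%:R^-1], and from then on the truncated integrand is zero at [u]. *)
Lemma small_jumps_cvg0 : small_jumps n.+1%:R @[n --> \oo] --> 0.
Proof.
pose f n := mn \_ `]0, n.+1%:R^-1]%classic.
have -> : (fun n => small_jumps n.+1%:R) = (fun n => \int[m]_(u in D) f n u).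
  apply/funext => n; rewrite /small_jumps -Rintegral_mkcondr.
  by congr (Rintegral _ _ _); apply/esym/setIidPr; exact: small_sub.
suff : (\int[m]_(u in D) (EFin \o f n) u)%E @[n --> \oo]
    --> (\int[m]_(u in D) (cst 0 u))%E.
  by rewrite integral0 => /fine_cvg.
apply: (dominated_cvg mD _ _ _ imn) => //.
- move=> n; apply/measurable_EFinP; apply: measurable_funTS.
  by apply/(measurable_restrictT _ _).1; [exact: measurable_itv | exact: mmn].
- move=> u; rewrite /D /= in_itv/= andbT => u0.
  apply: cvg_near_cst; near=> n.
  rewrite /= /f patchE memNset// /= in_itv/= u0/=; apply/negP; rewrite -ltNge.
  rewrite invf_plt ?posrE//.
  apply: (lt_trans (_ : _ < n%:R)); last by rewrite ltr_nat.
  by near: n; exact: nbhs_infty_gtr.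
- move=> n u /D_ge0 u0; rewrite /= /f patchE; case: ifP => _ /=.
    by rewrite lee_fin ger0_norm// mn_ge0.
  by rewrite normr0 lee_fin mn_ge0.
Unshelve. all: by end_near. Qed.

(** For [u > p^-1] and [p >= 1], [u <= p * min(u, u^2)]. Hence the retained jumps have a finite
    first moment, and the compensator [z * u] of the kernel can be integrated separately. *)
Lemma big_jumps_le p (E := `]p^-1, +oo[%classic : set (measurableTypeR R)) :
  1 <= p ->
  m.-integrable E (EFin \o id) /\ \int[m]_(u in E) u <= p * M.
Proof.
move=> p1; have p0 : 0 < p by exact: lt_le_trans p1.
have mE : measurable E by exact: measurable_itv.
have iE := integrableS mD mE (big_sub p0) imn.
have le_u u : E u -> u <= p * mn u.
  rewrite /E /= in_itv/= andbT => pu.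
  have u0 : 0 < u by apply: lt_trans pu; rewrite invr_gt0.
  apply: le_mul_min; [exact: ltW | by rewrite ler_peMl// ltW |].
  by rewrite expr2 mulrA ler_peMl ?(ltW u0)// -ler_pdivrMl// mulr1 ltW.
have E0 u : E u -> 0 <= u by move=> /(big_sub p0) /D_ge0.
have iu : m.-integrable E (EFin \o id).
  apply: le_integrable (integrableZl mE p iE) => //.
    by apply/measurable_EFinP; exact: measurable_id.
  move=> u Eu; rewrite /= lee_fin ger0_norm ?E0// ger0_norm ?le_u//.
  by apply: mulr_ge0; [exact: ltW | apply: mn_ge0; exact: E0].
split=> //; apply: (@le_trans _ _ (\int[m]_(u in E) (p * mn u))).
  apply: le_Rintegral => //.
  by apply: eq_integrable (integrableZl mE _ iE).
rewrite RintegralZl// ler_wpM2l ?(ltW p0)//.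
rewrite /M (Rintegral_jumps p0 imn) lerDr.
by apply: Rintegral_ge0 => u /small_sub /D_ge0 /mn_ge0.
Qed.

(** With [A = b + 2 * c * p + J], the step maps [z] to [(1 - d * A) * z] plus nonnegative multiples
    of [1 - expR (- (z / p))] and of the integral of [1 - expR (- (z * u))] over the big jumps. The
    bound on [d] makes [1 - d * A] nonnegative, since [b <= |b|] and [J <= p * M]. *)
Lemma bernstein_euler_step p (d : R) (w : nat -> R) : 1 <= p -> 0 <= d ->
  d * (`|b| + 2 * c * p + p * M) <= 1 -> bernstein w ->
  bernstein (fun k => w k - d * branching_approx p (w k)).
Proof.
move=> p1 d0 hd bw; have p0 : 0 < p by exact: lt_le_trans p1.
set E := `]p^-1, +oo[%classic : set (measurableTypeR R).
have mE : measurable E by exact: measurable_itv.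
have [iu Iu] := big_jumps_le p1.
set J := \int[m]_(u in E) u in Iu.
have w0 k : 0 <= w k by case: bw.
have i1 k : m.-integrable E (fun u => (1 - expR (- (u * w k)))%:E).
  have := integrableB mE (integrableZl mE (w k) iu)
    (integrable_levy_kernel (w0 k) mE (big_sub p0)).
  apply: eq_integrable => // u _; rewrite /= -EFinM -EFinB /levy_kernel.
  by congr EFin; rewrite (mulrC u); ring.
have A0 : 0 <= 1 - d * (b + 2 * c * p + J).
  rewrite subr_ge0; apply: le_trans hd; rewrite ler_wpM2l//.
  by have := ler_norm b; lra.
have B0 : 0 <= d * (c * (2 * p ^+ 2)) by rewrite !mulr_ge0// ltW.
have pV : 0 <= p^-1 by rewrite invr_ge0 ltW.
have bI u : E u -> bernstein (fun k => 1 - expR (- (u * w k))).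
  by move=> /(big_sub p0) /D_ge0 u0; exact: bernstein_1subexpRN.
apply: eq_bernstein (bernsteinD (bernsteinD (bernsteinZ A0 bw)
  (bernsteinZ B0 (bernstein_1subexpRN pV bw)))
  (bernsteinZ d0 (bernstein_Rintegral mE i1 bI))) => k.
have -> : \int[m]_(u in E) (1 - expR (- (u * w k)))
     = w k * J - \int[m]_(u in E) levy_kernel (w k) u.
  rewrite -RintegralZl// -RintegralB//; last 2 first.
  - by apply: eq_integrable (integrableZl mE _ iu).
  - exact: integrable_levy_kernel (big_sub p0).
  by apply: eq_Rintegral => u _; rewrite /levy_kernel (mulrC u); ring.
rewrite /branching_approx -/E [levy_kernel _ p^-1]/levy_kernel (mulrC p^-1).
by field; rewrite gt_eqF.
Qed.

End branching_approximation.

(** * Euler scheme for the cumulant equation *)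

Section cumulant_solutions.
Context {R : realType} (phi : R -> R) (lambda : R) (w : R -> R).
Hypothesis hw : cumulant_solution phi lambda w.
Implicit Types (s r T K : R).
Notation mu := (@lebesgue_measure R).

Lemma cumulant_ge0 s : 0 <= s -> 0 <= w s.
Proof. by case/hw. Qed.

Lemma cumulant_integrable s r : 0 <= s ->
  mu.-integrable `]s, r] (fun s => (phi (w s))%:E).
Proof.
move=> s0; have [rs|sr] := leP r s.
  by rewrite set_itv_ge ?bnd_simp -?leNgt//; exact: integrable_set0.
have [_ + _] := hw (le_trans s0 (ltW sr)).
apply: integrableS => //; apply: subset_itvr; by rewrite bnd_simp.
Qed.

Lemma cumulant_increment s r : 0 <= s -> s <= r ->
  w r - w s = - \int[mu]_(q in `]s, r]) phi (w q).
Proof.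
move=> s0 sr; have [_ ir er] := hw (le_trans s0 sr); have [_ _ es] := hw s0.
by rewrite -(Rintegral_itvB ir) ?bnd_simp// er es; ring.
Qed.

(** With [A = 0] this is a Lipschitz bound in time; with [A] the slope used by a numerical scheme it
    is the local error of one step. *)
Lemma cumulant_increment_le s r (A B : R) : 0 <= s -> s <= r ->
  (forall q, s <= q <= r -> `|phi (w q) - A| <= B) ->
  `|w r - w s + A * (r - s)| <= B * (r - s).
Proof.
move=> s0 sr h; have i1 := cumulant_integrable r s0.
have mE : measurable (`]s, r]%classic : set (measurableTypeR R)).
  exact: measurable_itv.
have muE : mu `]s, r] = (r - s)%:E.
  rewrite lebesgue_measure_itv/= lte_fin; case: ltP => [_|rs]; first by rewrite EFinB.
  have -> : r = s by apply/eqP; rewrite eq_le rs sr.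
  by rewrite subrr.
have ic (x : R) : mu.-integrable `]s, r] (EFin \o cst x).
  have muy : (mu `]s, r] < +oo)%E by rewrite muE ltry.
  apply: measurable_bounded_integrable => //.
  by exists `|x|; split=> [|y xy q _ /=]; [exact: num_real | exact: ltW].
have cstE x : \int[mu]_(q in `]s, r]) (cst x q) = x * (r - s).
  by rewrite Rintegral_cst//; congr (x * _); exact: (congr1 fine muE).
have i2 : mu.-integrable `]s, r] (EFin \o (fun q => A - phi (w q))).
  by apply: eq_integrable (integrableB mE (ic A) i1).
have -> : w r - w s + A * (r - s) = \int[mu]_(q in `]s, r]) (A - phi (w q)).
  by rewrite cumulant_increment// (RintegralB mE (ic A) i1) cstE; ring.
apply: (le_trans (le_normr_Rintegral mE i2)).
rewrite -cstE; apply: le_Rintegral => //.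
- exact: integrable_norm i2.
- move=> q; rewrite /= in_itv/= => /andP[/ltW sq qr].
  by rewrite distrC h// sq.
Qed.

(** Integrability of [phi (w s)] is part of being a solution, so the integral of its absolute value
    over [[0, T]] gives a bound before any regularity of [w] is known. *)
Lemma cumulant_bounded T : exists K, forall s, 0 <= s <= T -> w s <= K.
Proof.
have [T0|T0] := leP 0 T; last first.
  by exists 0 => s /andP[s0 /(le_trans s0)]; rewrite leNgt T0.
have [_ iT _] := hw T0.
exists (lambda + \int[mu]_(q in `[0, T]) `|phi (w q)|) => s /andP[s0 sT].
have [_ is_ ->] := hw s0; rewrite lerD2l.
apply: (le_trans (ler_norm _)); rewrite normrN.
apply: (le_trans (le_normr_Rintegral _ is_)) => //.
have in_ := integrable_norm is_; have iN := integrable_norm iT.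
rewrite /Rintegral fine_le//; [exact: integrable_fin_num | exact: integrable_fin_num |].
apply: ge0_subset_integral => //=.
- exact: measurable_int iN.
- by apply: subset_itvl; rewrite bnd_simp.
Qed.

Section euler.
Variables (psi : R -> R) (K L B eta d : R) (n : nat) (z : nat -> R).
Hypotheses (d0 : 0 <= d) (L0 : 0 <= L) (eta0 : 0 <= eta)
  (wK : forall s, 0 <= s <= n%:R * d -> w s <= K)
  (phi_lip : forall x y, 0 <= x <= K -> 0 <= y <= K ->
    `|phi y - phi x| <= L * `|y - x|)
  (phi_le : forall x, 0 <= x <= K -> `|phi x| <= B)
  (psi_near : forall x, 0 <= x <= K -> `|phi x - psi x| <= eta)
  (z0 : z 0%N = lambda) (zS : forall j, z j.+1 = z j - d * psi (z j))
  (zK : forall j, (j <= n)%N -> 0 <= z j <= K).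

(** Discrete Gronwall argument. Here [psi] is any approximation of [phi], the one driving the
    scheme. If [e] is the error at step [j], the next one is at most [e * (1 + L * d) + d * g]: in
    [g], the term [L * (B * d)] accounts for the motion of [w] within the step and [eta] for
    replacing [phi] by [psi]. *)
Lemma euler_error j : (j <= n)%N ->
  `|w (j%:R * d) - z j| <= j%:R * d * (L * (B * d) + eta) * (1 + L * d) ^+ j.
Proof.
have B0 : 0 <= B by apply: le_trans (phi_le (zK (leq0n n))).
set g := L * (B * d) + eta.
have g0 : 0 <= g by rewrite addr_ge0// !mulr_ge0.
have Ld1 : 1 <= 1 + L * d by rewrite lerDl mulr_ge0.
elim: j => [|j IH] jn.
  have [_ _ w0] := hw (lexx 0).
  by rewrite !mul0r w0 set_itv1 Rintegral_set1 subr0 z0 subrr normr0.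
have {}IH := IH (ltnW jn).
set s := j%:R * d in IH *; set r := j.+1%:R * d.
have s0 : 0 <= s by rewrite mulr_ge0.
have rE : r = s + d by rewrite /r -natr1 mulrDl mul1r.
have sr : s <= r by rewrite rE lerDl.
have rn : r <= n%:R * d by rewrite ler_wpM2r// ler_nat.
have rs : r - s = d by rewrite rE addrAC subrr add0r.
have wq q : s <= q <= r -> 0 <= w q <= K.
  move=> /andP[sq qr]; have q0 := le_trans s0 sq.
  by rewrite cumulant_ge0//= wK// q0 (le_trans qr).
have dw q : s <= q <= r -> `|w q - w s| <= B * d.
  move=> /andP[sq qr].
  have := @cumulant_increment_le s q 0 B s0 sq.
  rewrite mul0r addr0 => /(_ _)/le_trans; apply.
    move=> y /andP[sy yq]; rewrite subr0 phi_le// wq// sy/=.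
    exact: le_trans qr.
  by rewrite ler_wpM2l// -rs lerB.
have zj := zK (ltnW jn).
set e := `|w s - z j| in IH.
have H := @cumulant_increment_le s r (psi (z j)) (L * (B * d + e) + eta) s0 sr.
have {}H : `|w r - w s + psi (z j) * d| <= (L * (B * d + e) + eta) * d.
  rewrite rs in H; apply: H => q sqr.
  have -> : phi (w q) - psi (z j) = (phi (w q) - phi (z j)) + (phi (z j) - psi (z j)).
    by ring.
  apply: (le_trans (ler_normD _ _)); rewrite lerD ?psi_near//.
  apply: (le_trans (phi_lip zj (wq _ sqr))); rewrite ler_wpM2l//.
  have -> : w q - z j = (w q - w s) + (w s - z j) by ring.
  by apply: (le_trans (ler_normD _ _)); rewrite lerD2r dw.
have -> : w r - z j.+1 = (w s - z j) + (w r - w s + psi (z j) * d).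
  by rewrite zS; ring.
apply: (le_trans (ler_normD _ _)); rewrite -/e.
apply: (@le_trans _ _ (e * (1 + L * d) + d * g)).
  by apply: (le_trans (lerD (lexx _) H)); rewrite /g; lra.
apply: (@le_trans _ _ (s * g * (1 + L * d) ^+ j.+1 + d * g)).
  by rewrite lerD2r exprSr mulrA ler_wpM2r// (le_trans _ Ld1).
rewrite rE 2!mulrDl lerD2l.
by rewrite ler_peMr ?mulr_ge0// exprn_ege1.
Qed.

End euler.
End cumulant_solutions.

(** * Bernstein property of the cumulant in its initial value *)

Section cumulant_bernstein.
Context {R : realType} (b c : R) (m : {measure set (measurableTypeR R) -> \bar R}).
Hypotheses (hc : 0 <= c)
  (hm : (\int[m]_(u in `]0%R, +oo[) (Num.min u (u ^+ 2))%:E < +oo)%E).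
Variable v : R -> R -> R.
Hypothesis hv : forall lambda : R, 0 <= lambda ->
  cumulant_solution (branching_mechanism b c m) lambda (v ^~ lambda).
Let phi := branching_mechanism b c m.
Let M := \int[m]_(u in (`]0%R, +oo[%classic : set (measurableTypeR R)))
  (Num.min u (u ^+ 2)).

Let euler (p d x : R) j := iter j (fun y => y - d * branching_approx b c m p y) x.

Let M0 : 0 <= M.
Proof.
apply: Rintegral_ge0 => u; rewrite /= in_itv/= andbT => /ltW u0.
by rewrite le_min u0 exprn_ge0.
Qed.

Lemma small_jumps_ge0 (p : R) : 0 <= small_jumps m p.
Proof.
apply: Rintegral_ge0 => u; rewrite /= in_itv/= => /andP[/ltW u0 _].
by rewrite le_min u0 exprn_ge0.
Qed.

(** Each step multiplies a nonnegative iterate by at most [1 + |b| * d]. The bound does not depend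
    on [p], so a single compact interval contains the iterates of all the schemes. *)
Let euler_le (p d x : R) j : 0 < p -> 0 <= d ->
  (forall i, 0 <= euler p d x i) -> euler p d x j <= x * expR (`|b| * d * j%:R).
Proof.
move=> p0 d0 e0; have x0 : 0 <= x by exact: (e0 0%N).
have bd0 : 0 <= `|b| * d by rewrite mulr_ge0.
suff H : euler p d x j <= x * (1 + `|b| * d) ^+ j.
  apply: (le_trans H); rewrite ler_wpM2l// expRM_natr.
  by rewrite lerXn2r ?nnegrE ?addr_ge0 ?expR_ge0// expR_ge1Dx.
elim: j => [|j IH]; first by rewrite mulr1.
apply: (@le_trans _ _ (euler p d x j * (1 + `|b| * d))); last first.
  by rewrite exprSr mulrA ler_wpM2r// addr_ge0.
have H := branching_approx_ge b m hc p0 (e0 j).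
rewrite /euler iterS -/(euler p d x j); set y := euler p d x j in H *.
have y0 : 0 <= y by exact: e0.
have H1 := ler_wpM2l d0 H.
have H2 : - `|b| * (d * y) <= b * (d * y).
  by rewrite ler_wpM2r ?mulr_ge0// lerNl ler_normr lexx orbT.
lra.
Qed.

(** Euler iterates started from an affine sequence stay Bernstein and converge to the cumulant. The
    step [h] is arbitrary: [h = 1] serves the Laplace transforms at integers, and
    [h = lambda' - lambda] gives monotonicity in the initial value. *)
Lemma cumulant_bernstein t lambda h : 0 <= t -> 0 <= lambda -> 0 <= h ->
  bernstein (fun k => v t (lambda + h * k%:R)).
Proof.
move=> t0 l0 h0.
have S0 : 0 <= t * (`|b| + 2 * c + M).
  by rewrite mulr_ge0// !addr_ge0// mulr_ge0.
have [Q hQ] : exists Q, t * (`|b| + 2 * c + M) <= Q.+1%:R :> R.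
  by exists (Num.trunc (t * (`|b| + 2 * c + M))); rewrite ltW// truncnS_gt.
(* The cutoff [p] and the number of steps [Q.+1 * N.+1] grow together: then [d * p = t / Q.+1], and
   the choice of [Q] yields the step condition of [bernstein_euler_step] for every [N]. *)
pose p N : R := N.+1%:R.
pose d N : R := t / (Q.+1 * N.+1)%:R.
have p1 N : 1 <= p N by rewrite /p ler1n.
have p0 N : 0 < p N by rewrite ltr0n.
have Q0 : 0 < Q.+1%:R :> R by rewrite ltr0n.
have dE N : d N = t / Q.+1%:R * (p N)^-1.
  by rewrite /d natrM invfM mulrA.
have d0 N : 0 <= d N by rewrite divr_ge0.
have nd N : (Q.+1 * N.+1)%:R * d N = t.
  by rewrite /d mulrC divfK// pnatr_eq0.
have dS N : d N * (`|b| + 2 * c * p N + p N * M) <= 1.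
  apply: (@le_trans _ _ (d N * (p N * (`|b| + 2 * c + M)))).
    rewrite ler_wpM2l//.
    have : `|b| <= p N * `|b| by rewrite ler_peMl.
    lra.
  rewrite dE mulrA divfK ?gt_eqF// mulrAC ler_pdivrMr// mul1r.
  exact: hQ.
have bz N j : bernstein (fun k => euler (p N) (d N) (lambda + h * k%:R) j).
  elim: j => [|j IH]; first exact: bernstein_affine.
  exact: (bernstein_euler_step hc hm).
apply: (@bernstein_lim _
  (fun N k => euler (p N) (d N) (lambda + h * k%:R) (Q.+1 * N.+1))) => // k.
set x := lambda + h * k%:R.
have x0 : 0 <= x by rewrite addr_ge0// mulr_ge0.
have e0 N i : 0 <= euler (p N) (d N) x i.
  by have [+ _] := bz N i; exact.
have [K1 hK1] := cumulant_bounded (hv x0) t.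
(* [K] bounds the solution on [[0, t]] and the iterates of every scheme, so [L] and [B] do not
   depend on [N]. *)
pose K := Num.max K1 (x * expR (`|b| * t)).
have K0 : 0 <= K by rewrite le_max (mulr_ge0 x0 (expR_ge0 _)) orbT.
pose L := branching_lipschitz_const b c m K.
have L0 : 0 <= L.
  by rewrite /L /branching_lipschitz_const !addr_ge0// mulr_ge0// ?mulr_ge0// addr_ge0.
pose B := L * K + `|phi 0|.
pose eta N := c * (K ^+ 3 / p N) + (K + K ^+ 2) * small_jumps m (p N).
have s0 N := small_jumps_ge0 (p N).
have eta0 N : 0 <= eta N.
  by rewrite addr_ge0// mulr_ge0 ?addr_ge0 ?divr_ge0 ?exprn_ge0// ltW.
have err N : `|v t x - euler (p N) (d N) x (Q.+1 * N.+1)|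
    <= t * (L * (B * d N) + eta N) * expR (L * t).
  have := @euler_error _ _ _ _ (hv x0) (branching_approx b c m (p N)) K L B
    (eta N) (d N) (Q.+1 * N.+1) (euler (p N) (d N) x) (d0 N) L0 (eta0 N).
  rewrite nd => H; rewrite -[t in v t x](nd N).
  apply: le_trans (H _ _ _ _ _ _ _ _ (leqnn _)) _ => //.
  - by move=> s st; rewrite le_max hK1.
  - by move=> y z hy hz; exact: branching_lipschitz.
  - by move=> y hy; exact: branching_bounded.
  - move=> y /andP[y0 yK].
    apply: (le_trans (branching_approx_dist b hc hm (p0 N) y0)).
    rewrite /eta lerD//.
      by rewrite ler_wpM2l// ler_wpM2r ?invr_ge0 ?(ltW (p0 N))// lerXn2r.
    by rewrite ler_wpM2r// lerD// lerXn2r.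
  - move=> j jn; rewrite e0 /= le_max; apply/orP; right.
    apply: (le_trans (euler_le j (p0 N) (d0 N) (e0 N))).
    rewrite ler_wpM2l// ler_expR -mulrA ler_wpM2l// -[leRHS](nd N) mulrC.
    by rewrite ler_wpM2r// ler_nat.
  - rewrite nd ler_wpM2l//.
      by rewrite mulr_ge0// addr_ge0// !mulr_ge0// /B addr_ge0// mulr_ge0.
    (* The Gronwall factor [(1 + L * d)^n] is at most [expR (L * d * n)], and [d * n = t]. *)
    have -> : expR (L * t) = expR (L * d N) ^+ (Q.+1 * N.+1).
      by rewrite -expRM_natl -(nd N) mulrCA.
    by rewrite lerXn2r ?nnegrE ?addr_ge0 ?mulr_ge0 ?expR_ge0// expR_ge1Dx.
have pV0 : (p N)^-1 @[N --> \oo] --> 0 by exact: cvg_harmonic.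
have bnd0 : t * (L * (B * d N) + eta N) * expR (L * t) @[N --> \oo] --> 0.
  rewrite -[X in _ --> X](_ : t * (L * (B * (t / Q.+1%:R * 0))
    + (c * (K ^+ 3 * 0) + (K + K ^+ 2) * 0)) * expR (L * t) = 0); last by ring.
  apply: cvgMr_tmp; apply: cvgMl_tmp; apply: cvgD.
    apply: cvgMl_tmp; apply: cvgMl_tmp.
    rewrite (_ : d = fun N => t / Q.+1%:R * (p N)^-1); last exact/funext.
    exact: cvgMl_tmp.
  apply: cvgD; first by apply: cvgMl_tmp; exact: cvgMl_tmp.
  by apply: cvgMl_tmp; exact: small_jumps_cvg0.
apply/cvgrPdist_le => e e_gt0; near=> N.
apply: (le_trans (err N)).
near: N; move/cvgrPdist_le : bnd0 => /(_ e e_gt0).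
apply: filterS => N; rewrite sub0r normrN; apply: le_trans; exact: ler_norm.
Unshelve. all: by end_near. Qed.

End cumulant_bernstein.

(** * The limit of the cumulant at infinity *)

Section cumulant_limit.
Context {R : realType} (b c : R) (m : {measure set (measurableTypeR R) -> \bar R}).
Hypotheses (hc : 0 <= c)
  (hm : (\int[m]_(u in `]0%R, +oo[) (Num.min u (u ^+ 2))%:E < +oo)%E).
Let phi := branching_mechanism b c m.
Notation mu := (@lebesgue_measure R).

Section one_solution.
Variables (lambda : R) (w : R -> R).
Hypothesis hw : cumulant_solution phi lambda w.

Lemma cumulant_lipschitz T : exists2 B, 0 <= B &
  forall s r, 0 <= s <= T -> 0 <= r <= T -> `|w r - w s| <= B * `|r - s|.
Proof.
have [K hK] := cumulant_bounded hw T.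
exists (`|branching_lipschitz_const b c m K * K + `|phi 0| |) => // s r.
wlog sr : s r / s <= r => [wl hs hr|].
  by case: (leP s r) => [|/ltW] ?; [|rewrite distrC (distrC r)]; apply: wl.
move=> /andP[s0 sT] /andP[r0 rT]; rewrite (ger0_norm (_ : 0 <= r - s)) ?subr_ge0//.
set B := branching_lipschitz_const b c m K * K + `|phi 0|.
have := @cumulant_increment_le _ _ _ _ hw s r 0 `|B| s0 sr.
rewrite mul0r addr0; apply => q /andP[sq qr]; rewrite subr0.
apply: le_trans (ler_norm _); apply: branching_bounded => //.
have q0 := le_trans s0 sq.
by rewrite (cumulant_ge0 hw q0) hK// q0 (le_trans qr).
Qed.

Variable theta : R.
Hypothesis (htheta : 0 < theta) (hphi_pos : forall z, theta <= z -> 0 < phi z).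

(* After the last time at which [w] is at most [theta], [w] decreases. *)
Lemma cumulant_stays_below s t : 0 <= s -> s <= t -> w s <= theta -> w t <= theta.
Proof.
move=> s0 st ws; have [B B0 hB] := cumulant_lipschitz t.
have t0 := le_trans s0 st.
pose A := [set r | s <= r <= t /\ w r <= theta].
have As : A s by rewrite /A /= lexx st.
have supA : has_sup A by split; [exists s | exists t => r [/andP[_ ]]].
set a := sup A.
have sa : s <= a by apply: ub_le_sup => //; case: supA.
have at_ : a <= t by apply: sup_le_ub; [exists s | move=> r [/andP[_ ]]].
have a0 := le_trans s0 sa.
(* The Lipschitz bound in time carries the inequality to the supremum [a], which is approached
   within [e / (B + 1)] because [B] may be zero. *)
have wa : w a <= theta.
  apply/ler_addgt0Pr => e e0.
  have d0 : 0 < e / (B + 1) by rewrite divr_gt0// ltr_wpDl.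
  have [r [/andP[sr rt] wr] ar] := sup_adherent d0 supA.
  have ra : r <= a by apply: ub_le_sup; [case: supA | split; rewrite ?sr].
  have r0 := le_trans s0 sr.
  have := hB r a; rewrite r0 rt a0 at_ (ger0_norm (_ : 0 <= a - r)) ?subr_ge0//.
  move=> /(_ erefl erefl)/(le_trans (ler_norm _)) h.
  have : B * (a - r) <= e.
    apply: (@le_trans _ _ ((B + 1) * (e / (B + 1)))); last first.
      by rewrite mulrC divfK// gt_eqF// ltr_wpDl.
    apply: ler_pM => //; [by rewrite subr_ge0 | by rewrite lerDl |].
    by rewrite lerBlDl -lerBlDr ltW.
  lra.
apply: le_trans wa; rewrite -subr_le0 (cumulant_increment hw a0 at_) oppr_le0.
apply: Rintegral_ge0 => q; rewrite /= in_itv/= => /andP[aq qt].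
apply: ltW; apply: hphi_pos; rewrite leNgt; apply/negP => /ltW wq.
have : q <= a.
  by apply: ub_le_sup; [case: supA | split=> //; rewrite (le_trans sa (ltW aq))].
by rewrite leNgt aq.
Qed.

(** By [cumulant_stays_below], a final value above [theta] forces [w] above [theta] on all of
    [[s, t]], where [phi (w q)] is then positive. *)
Lemma cumulant_decreases s t : 0 <= s -> s <= t -> theta < w t -> w t <= w s.
Proof.
move=> s0 st wt; rewrite -subr_le0 (cumulant_increment hw s0 st) oppr_le0.
apply: Rintegral_ge0 => q; rewrite /= in_itv/= => /andP[/ltW sq qt].
apply: ltW; apply: hphi_pos; rewrite leNgt; apply/negP => /ltW wq.
have := cumulant_stays_below (le_trans s0 sq) qt wq.
by rewrite leNgt wt.
Qed.

(** Stated for the right-hand side of the integral equation, which is known to equal [w] only at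
    nonnegative times. The fundamental theorem of calculus applies since [w] is Lipschitz and [phi]
    is continuous at [w s > theta > 0]. *)
Lemma is_derive_cumulant s t : 0 < s < t -> theta < w t ->
  is_derive s 1 (fun r => lambda - \int[mu]_(q in `[0, r]) phi (w q)) (- phi (w s)).
Proof.
move=> /andP[s0 st] wt; have [_ it _] := hw (ltW (lt_trans s0 st)).
have ws : theta < w s := lt_le_trans wt (cumulant_decreases (ltW s0) (ltW st) wt).
have cw : {for s, continuous w}.
  have [B B0 hB] := cumulant_lipschitz t.
  apply/cvgrPdist_le => e e0; near=> r.
  have rst : 0 <= r <= t.
    have : `|s - r| <= Num.min s (t - s).
      by near: r; apply: cvgr_dist_le; [exact: cvg_id | rewrite lt_min s0 subr_gt0].
    rewrite le_min !ler_norml => /andP[/andP[_ ?] /andP[? _]].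
    by apply/andP; split; lra.
  have sst : 0 <= s <= t by rewrite !ltW.
  apply: (le_trans (hB _ _ rst sst)).
  apply: (@le_trans _ _ ((B + 1) * `|s - r|)); first by rewrite ler_wpM2r// lerDl.
  rewrite mulrC -ler_pdivlMr; last by rewrite ltr_wpDl.
  by near: r; apply: cvgr_dist_le; [exact: cvg_id | rewrite divr_gt0 ?ltr_wpDl].
have cphi : {for s, continuous (phi \o w)}.
  apply: continuous_comp => //; apply: branching_continuous => //.
  exact: lt_trans ws.
have [dF FE] := continuous_FTC1_closed st it s0 cphi.
have dI : is_derive s 1 (fun r => \int[mu]_(q in `[0, r]) phi (w q)) (phi (w s)).
  by rewrite derive1E in FE; exact: DeriveDef dF FE.
have := is_deriveB (is_derive_cst lambda s 1) dI.
by rewrite sub0r.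
Unshelve. all: by end_near. Qed.

End one_solution.

Variable theta : R.
Hypotheses (htheta : 0 < theta) (hphi_pos : forall z, theta <= z -> 0 < phi z)
  (hphi_int : (\int[mu]_(z in `[theta, +oo[) ((phi z)^-1)%:E < +oo)%E).

(** [G z] is the time a solution takes to come down from [z] to [theta]. *)
Let G z := \int[mu]_(y in `[theta, z]) (phi y)^-1.

Let phiV_continuous z : theta <= z -> {for z, continuous (fun y => (phi y)^-1)}.
Proof.
move=> tz; apply: continuousV; first by rewrite gt_eqF// hphi_pos.
by apply: branching_continuous => //; exact: lt_le_trans tz.
Qed.

Let iphiV : mu.-integrable `[theta, +oo[ (fun z => ((phi z)^-1)%:E).
Proof.
apply/integrableP; split.
  apply/measurable_EFinP; apply: subspace_continuous_measurable_fun.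
    exact: measurable_itv.
  apply: continuous_in_subspaceT => z; rewrite inE/= in_itv/= andbT => tz.
  exact: phiV_continuous.
apply: le_lt_trans hphi_int; rewrite le_eqVlt; apply/orP; left; apply/eqP.
apply: eq_integral => z; rewrite inE/= in_itv/= andbT => tz.
by rewrite /= ger0_norm// invr_ge0 ltW// hphi_pos.
Qed.

Let iphiV_le z : mu.-integrable `[theta, z] (fun z => ((phi z)^-1)%:E).
Proof. by apply: integrableS iphiV => //; exact: subset_itvl. Qed.

Let G_nd y z : theta <= y -> y <= z -> G y <= G z.
Proof.
move=> ty yz; rewrite -subr_ge0 /G.
rewrite (Rintegral_itvB (iphiV_le z)) ?bnd_simp//.
apply: Rintegral_ge0 => q; rewrite /= in_itv/= => /andP[/ltW yq _].
by rewrite invr_ge0 ltW// hphi_pos// (le_trans ty).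
Qed.

Let G_bounded z : theta <= z -> G z <= \int[mu]_(y in `[theta, +oo[) (phi y)^-1.
Proof.
move=> tz; rewrite -subr_ge0 /G.
rewrite (Rintegral_itvB iphiV) ?bnd_simp//.
apply: Rintegral_ge0 => q; rewrite /= in_itv/= => /andP[/ltW zq _].
by rewrite invr_ge0 ltW// hphi_pos// (le_trans tz).
Qed.

Let G_derive z : theta < z -> is_derive z 1 G (phi z)^-1.
Proof.
move=> tz; have zz : z < z + 1 by rewrite ltrDl.
have [dG GE] := continuous_FTC1_closed zz (iphiV_le _) tz (phiV_continuous (ltW tz)).
by rewrite derive1E in GE; exact: DeriveDef dG GE.
Qed.

(* [G (w s) + s] is constant as long as [w] stays above [theta]. *)
Let G_cumulant lambda w s r t : cumulant_solution phi lambda w ->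
  0 < s -> s < r -> r < t -> theta < w t -> G (w r) - G (w s) = - (r - s).
Proof.
move=> hw s0 sr rt wt.
pose W q := lambda - \int[mu]_(y in `[0, q]) phi (w y).
have WE q : 0 <= q -> W q = w q by move=> /hw[_ _ ->].
have hG q : s <= q <= r -> is_derive q 1 (G \o W) (-1).
  move=> /andP[sq qr]; have q0 := lt_le_trans s0 sq; have qt := le_lt_trans qr rt.
  have wq : theta < w q.
    exact: lt_le_trans wt (cumulant_decreases hw hphi_pos (ltW q0) (ltW qt) wt).
  have := is_derive1_comp (_ : is_derive (W q) 1 G (phi (W q))^-1)
    (is_derive_cumulant hw htheta hphi_pos (_ : 0 < q < t) wt).
  rewrite WE ?(ltW q0)// mulrN mulVf ?gt_eqF ?hphi_pos ?(ltW wq)//; apply.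
    exact: G_derive.
  by rewrite q0.
have [y] : exists2 y, y \in `[s, r] & (G \o W) r - (G \o W) s = -1 * (r - s).
  apply: MVT_segment; first exact: ltW.
    by move=> q; rewrite in_itv/= => /andP[/ltW sq /ltW qr]; apply: hG; rewrite sq.
  apply: derivable_within_continuous => q; rewrite in_itv/= => /hG h.
  exact: ex_derive.
by move=> _ /=; rewrite !WE ?mulN1r// ltW// (lt_trans s0).
Qed.

(** [G] is bounded on [[theta, +oo[]; the bound [z0] is chosen with [G z0] within [t / 2] of the
    supremum, independently of [lambda]. If [w t] exceeded [z0], then [G (w s)] would drop by
    exactly [t / 2] from [s = t / 4] to [s = 3 * t / 4] and still be at least [G z0], so it would
    have started above the supremum. The quarter points keep both times strictly inside []0, t[], as
    [G_cumulant] requires. *)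
Lemma cumulant_uniformly_bounded (v : R -> R -> R) t : 0 < t ->
  (forall lambda, 0 <= lambda -> cumulant_solution phi lambda (v ^~ lambda)) ->
  exists B, forall lambda, 0 <= lambda -> v t lambda <= B.
Proof.
move=> t0 hv; pose A := G @` [set z | theta <= z].
have supA : has_sup A.
  split; first by exists (G theta), theta => /=.
  exists (\int[mu]_(y in `[theta, +oo[) (phi y)^-1) => _ [z tz <-].
  exact: G_bounded.
have t2 : 0 < t / 2 by rewrite divr_gt0.
have [_ [z0 tz0 <-] hz0] := sup_adherent t2 supA.
exists z0 => lambda l0; rewrite leNgt; apply/negP => zt.
have hw := hv _ l0; set w := v ^~ lambda in hw.
have wt : theta < w t := le_lt_trans tz0 zt.
have s0 : 0 < t / 4 by rewrite divr_gt0.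
have sr : t / 4 < 3 * t / 4 by lra.
have rt : 3 * t / 4 < t by lra.
have E := G_cumulant hw s0 sr rt wt.
have wr : w t <= w (3 * t / 4).
  by apply: (cumulant_decreases hw hphi_pos) => //; lra.
have ws : theta <= w (t / 4).
  apply/ltW/(lt_le_trans wt).
  by apply: (cumulant_decreases hw hphi_pos) => //; lra.
have h1 : G (w (t / 4)) <= sup A by apply: ub_le_sup; [case: supA | exists (w (t / 4))].
have h2 : G z0 <= G (w (3 * t / 4)) by apply: G_nd => //; apply: le_trans wr; exact: ltW.
lra.
Qed.

Lemma cumulant_nd (v : R -> R -> R) t lambda lambda' : 0 <= t ->
  (forall lambda, 0 <= lambda -> cumulant_solution phi lambda (v ^~ lambda)) ->
  0 <= lambda -> lambda <= lambda' -> v t lambda <= v t lambda'.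
Proof.
move=> t0 hv l0 ll; have h0 : 0 <= lambda' - lambda by rewrite subr_ge0.
have := bernstein_nd 0 (cumulant_bernstein hc hm hv t0 l0 h0).
by rewrite mulr0 addr0 mulr1 subrKC.
Qed.

Lemma cumulant_le_vbar (v : R -> R -> R) t (k : nat) : 0 < t ->
  (forall lambda, 0 <= lambda -> cumulant_solution phi lambda (v ^~ lambda)) ->
  v t k%:R <= vbar v t.
Proof.
move=> t0 hv; have [B hB] := cumulant_uniformly_bounded t0 hv.
(* Nothing is known of [v] at negative [lambda]. Clipping at 0 gives a function monotone on the
   whole line with the same limit at [+oo], so the [lim] in [vbar] is a genuine limit, equal to a
   supremum. *)
pose f (x : R) := v t (Num.max 0 x).
have max0 x : 0 <= Num.max 0 x :> R by rewrite le_max lexx.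
have fnd : nondecreasing_fun f.
  move=> x y xy; apply: cumulant_nd => //; first exact: ltW.
  by rewrite ge_max !le_max lexx xy orbT.
have fub : has_ubound (range f) by exists B => _ [x _ <-]; exact: hB.
have vE : vbar v t = sup (range f).
  apply/cvg_lim => //; apply: cvg_trans (nondecreasing_cvgr fnd fub).
  apply: near_eq_cvg; near=> x.
  by rewrite /f max_r//; near: x; exact: nbhs_pinfty_ge.
rewrite vE; apply: ub_le_sup => //; exists k%:R => //.
by rewrite /f max_r.
Unshelve. all: by end_near. Qed.

End cumulant_limit.

(** * Bernstein polynomials *)

Section bernstein_operator.
Context {R : realType}.
Implicit Types (x y A C L : R) (f g : nat -> R).

(* The mean of [f] under the binomial law of parameters [n] and [x], computed
   by conditioning on the first trial. *)
Fixpoint binomial_mean x n f : R :=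
  if n is n'.+1 then
    x * binomial_mean x n' (fun i => f i.+1) + (1 - x) * binomial_mean x n' f
  else f 0%N.

Lemma le_binomial_mean x n f g : 0 <= x <= 1 -> (forall i, f i <= g i) ->
  binomial_mean x n f <= binomial_mean x n g.
Proof.
move=> /andP[x0 x1]; elim: n f g => [|n IH] f g fg /=; first exact: fg.
by rewrite lerD// ler_wpM2l ?subr_ge0// IH.
Qed.

(** Variance plus squared bias of the binomial law. The centre [y] is general because a success in
    the first trial shifts it to [y - 1]. *)
Lemma binomial_mean_square x n A C y :
  binomial_mean x n (fun i => A + C * (i%:R - y) ^+ 2)
  = A + C * (n%:R * x * (1 - x) + (n%:R * x - y) ^+ 2).
Proof.
elim: n y => [|n IH] y /=; first by ring.
have -> : (fun i : nat => A + C * (i.+1%:R - y) ^+ 2)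
        = (fun i : nat => A + C * (i%:R - (y - 1)) ^+ 2).
  by apply/funext => i; rewrite -natr1; ring.
by rewrite !IH -natr1; ring.
Qed.

Lemma binomial_mean_cst x n A : binomial_mean x n (fun=> A) = A.
Proof.
have := binomial_mean_square x n A 0 0; rewrite mul0r addr0 => {2}<-.
by congr binomial_mean; apply/funext => i; rewrite mul0r addr0.
Qed.

(* [2 e s <= e ^ 2 + s ^ 2] turns the Lipschitz bound into a quadratic one,
   whose binomial mean is explicit. *)
Lemma binomial_mean_lipschitz x n (g : R -> R) L (e : R) : 0 <= x <= 1 ->
  (forall y z, `|g y - g z| <= L * `|y - z|) -> 0 < e -> 0 <= L ->
  `|binomial_mean x n.+1 (fun i => g (i%:R / n.+1%:R)) - g x|
    <= L * (e + (n.+1%:R * e)^-1).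
Proof.
move=> x01 lip e0 L0; set N : R := n.+1%:R.
have N0 : 0 < N by rewrite ltr0n.
have N1 : N != 0 by rewrite gt_eqF.
have e1 : e != 0 by rewrite gt_eqF.
pose C := L / (e * N ^+ 2).
have C0 : 0 <= C by rewrite divr_ge0// mulr_ge0 ?exprn_ge0// ltW.
have hg i : `|g (i%:R / N) - g x| <= L * e + C * (i%:R - N * x) ^+ 2.
  apply: (le_trans (lip _ _)).
  set s : R := `|_|; have s2 : (i%:R - N * x) ^+ 2 = N ^+ 2 * s ^+ 2.
    by rewrite /s real_normK ?num_real//; field.
  have -> : C * (i%:R - N * x) ^+ 2 = L * (s ^+ 2 / e).
    by rewrite s2 /C; field; rewrite e1 addrC natr1 N1.
  rewrite -mulrDr ler_wpM2l//.
  rewrite -(ler_pM2r e0) mulrDl divfK//.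
  have := sqr_ge0 (e - s); have := sqr_ge0 e; have := sqr_ge0 s; nra.
have hm : L * e + C * (N * x * (1 - x)) <= L * (e + (N * e)^-1).
  rewrite [leRHS]mulrDr lerD2l.
  have -> : L * (N * e)^-1 = C * N by rewrite /C; field; rewrite e1 addrC natr1 N1.
  rewrite ler_wpM2l// -mulrA ger_pMr//; case/andP: x01 => x0 x1; nra.
have lo : g x - L * e + - C * (N * x * (1 - x) + (N * x - N * x) ^+ 2)
    <= binomial_mean x n.+1 (fun i => g (i%:R / N)).
  rewrite -binomial_mean_square; apply: le_binomial_mean => // i.
  by have := hg i; rewrite ler_norml => /andP[+ _]; lra.
have hi : binomial_mean x n.+1 (fun i => g (i%:R / N))
    <= g x + L * e + C * (N * x * (1 - x) + (N * x - N * x) ^+ 2).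
  rewrite -binomial_mean_square; apply: le_binomial_mean => // i.
  by have := hg i; rewrite ler_norml => /andP[_]; lra.
move: (binomial_mean x n.+1 _) (L * (e + _)) hm lo hi => B F.
rewrite subrr expr0n/= addr0 mulNr; move: (C * _) => E hm lo hi.
by rewrite ler_norml; apply/andP; split; lra.
Qed.

Lemma binomial_mean_cvg x (g : R -> R) L : 0 <= x <= 1 -> 0 <= L ->
  (forall y z, `|g y - g z| <= L * `|y - z|) ->
  binomial_mean x n.+1 (fun i => g (i%:R / n.+1%:R)) @[n --> \oo] --> g x.
Proof.
move=> x01 L0 lip; apply/cvgrPdist_le => e e0.
have L1 : 0 < L + 1 by rewrite ltr_wpDl.
(* Chosen so that [(L + 1) * (d + d) = e]; the term [(n.+1%:R * d)^-1] is below [d] for large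
   [n]. *)
pose d := e / (2 * (L + 1)); have d0 : 0 < d by rewrite divr_gt0// mulr_gt0.
near=> n; rewrite distrC.
apply: (le_trans (binomial_mean_lipschitz n x01 lip d0 L0)).
have h : (n.+1%:R * d)^-1 <= d.
  rewrite invfM -ler_pdivlMr ?invr_gt0// invrK.
  near: n; have : harmonic @ \oo --> (0 : R) := cvg_harmonic.
  move/cvgrPdist_le => /(_ (d * d) (mulr_gt0 d0 d0)); apply: filterS => n.
  by rewrite sub0r normrN; apply: le_trans; exact: ler_norm.
apply: (@le_trans _ _ ((L + 1) * (d + d))).
  apply: ler_pM => //; [|by rewrite lerDl|by rewrite lerD2l].
  by apply: addr_ge0; [exact: ltW | rewrite invr_ge0; apply: mulr_ge0 => //; exact: ltW].
by rewrite /d le_eqVlt; apply/orP; left; apply/eqP; field; rewrite gt_eqF.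
Unshelve. all: by end_near. Qed.

Lemma min_dist_le (a b a' b' K : R) : `|a - a'| <= K -> `|b - b'| <= K ->
  `|Num.min a b - Num.min a' b'| <= K.
Proof.
rewrite !ler_norml => /andP[? ?] /andP[? ?].
by case: (leP a b) => ?; case: (leP a' b') => ?; apply/andP; split; lra.
Qed.

Lemma max_dist_le (a b a' b' K : R) : `|a - a'| <= K -> `|b - b'| <= K ->
  `|Num.max a b - Num.max a' b'| <= K.
Proof.
rewrite !ler_norml => /andP[? ?] /andP[? ?].
by case: (leP a b) => ?; case: (leP a' b') => ?; apply/andP; split; lra.
Qed.

(** A [j]-Lipschitz approximation of the indicator of [[p, q[]. The rising edge lies left of [p] and
    the falling edge left of [q], so that the pointwise limit is 1 at [p] and 0 at [q]. *)
Definition trapezoid (p q : R) (j : nat) (x : R) : R :=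
  Num.max 0 (Num.min 1 (Num.min (1 + j%:R * (x - p)) (j%:R * (q - x)))).

Lemma trapezoid_lipschitz p q j x y :
  `|trapezoid p q j x - trapezoid p q j y| <= j%:R * `|x - y|.
Proof.
have K0 : 0 <= j%:R * `|x - y| by rewrite mulr_ge0.
have jE : `|j%:R * (x - y)| = j%:R * `|x - y| by rewrite normrM ger0_norm.
apply: max_dist_le; first by rewrite subrr normr0.
apply: min_dist_le; first by rewrite subrr normr0.
apply: min_dist_le; rewrite -jE.
  by rewrite le_eqVlt; apply/orP; left; apply/eqP; congr (`|_|); ring.
by rewrite -normrN le_eqVlt; apply/orP; left; apply/eqP; congr (`|_|); ring.
Qed.

Lemma trapezoid_ge0 p q j x : 0 <= trapezoid p q j x.
Proof. by rewrite le_max lexx. Qed.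

Lemma trapezoid_le1 p q j x : trapezoid p q j x <= 1.
Proof. by rewrite ge_max ler01 ge_min lexx. Qed.

Lemma trapezoid_cvg p q x :
  trapezoid p q j x @[j --> \oo] --> ((p <= x < q)%R%:R : R).
Proof.
apply: cvg_near_cst.
have big (z : R) : 0 < z -> \forall j \near \oo, 1 <= j%:R * z.
  move=> z0; near=> j; rewrite -ler_pdivrMr//.
  by near: j; exact: nbhs_infty_ger.
have [xp|px] := ltP x p.
  have px0 : 0 < p - x by rewrite subr_gt0.
  apply: filterS (big _ px0) => j hj /=.
  rewrite /trapezoid max_l// !ge_min; apply/orP; right; apply/orP; left.
  by rewrite -(opprB p x) mulrN subr_le0.
have [xq|qx] := ltP x q.
  have xq0 : 0 < q - x by rewrite subr_gt0.
  apply: filterS (big _ xq0) => j hj /=.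
  have h1 : 1 <= 1 + j%:R * (x - p) by rewrite lerDl mulr_ge0// subr_ge0.
  rewrite /trapezoid min_l; last by rewrite le_min h1.
  by rewrite max_r.
apply: nearW => j /=.
rewrite /trapezoid max_l// !ge_min; apply/orP; right; apply/orP; right.
by rewrite mulr_ge0_le0// subr_le0.
Unshelve. all: by end_near. Qed.

End bernstein_operator.

(** * Hausdorff positivity and domination *)

Section hausdorff_positivity.
Context {R : realType} (mu nu : {measure set (measurableTypeR R) -> \bar R}) (a : R).
Let H : set (measurableTypeR R) := `[0, +oo[%classic.
Hypotheses (muH : mu H = 1%E) (nuH : nu H = 1%E).
Implicit Types (f g : measurableTypeR R -> R).

Let mH : measurable H. Proof. exact: measurable_itv. Qed.

(** The bound is required on [[0, +oo[] only: [expR (- y)] is unbounded on the negative half-line,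
    which carries none of the integrals. *)
Definition bounded_measurable f :=
  measurable_fun setT f /\ exists C, forall y, 0 <= y -> `|f y| <= C.
Notation bm := bounded_measurable.

Lemma bounded_measurableD f g : bm f -> bm g -> bm (fun y => f y + g y).
Proof.
move=> [mf [C hC]] [mg [D hD]]; split; first exact: measurable_funD.
by exists (C + D) => y y0; rewrite (le_trans (ler_normD _ _))// lerD ?hC ?hD.
Qed.

Lemma bounded_measurableM f g : bm f -> bm g -> bm (fun y => f y * g y).
Proof.
move=> [mf [C hC]] [mg [D hD]]; split; first exact: measurable_funM.
by exists (C * D) => y y0; rewrite normrM ler_pM ?hC ?hD.
Qed.

Lemma bounded_measurable_cst (x : R) : bm (fun=> x).
Proof. by split; [exact: measurable_cst | exists `|x|]. Qed.

Lemma bounded_measurableX f n : bm f -> bm (fun y => f y ^+ n).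
Proof.
move=> hf; elim: n => [|n IH]; first exact: bounded_measurable_cst.
under eq_fun do rewrite exprS.
exact: bounded_measurableM.
Qed.

Lemma bounded_measurable_integrable (m : {measure set (measurableTypeR R) -> \bar R}) f :
  m H = 1%E -> bm f -> m.-integrable H (EFin \o f).
Proof.
move=> m1 [mf [C hC]]; apply: measurable_bounded_integrable => //.
- by rewrite m1 ltry.
- exact: measurable_funTS.
- exists C; split=> [|M CM y]; first exact: num_real.
  by rewrite /H /= in_itv/= andbT => y0; rewrite (le_trans (hC _ y0))// ltW.
Qed.

Let X (y : measurableTypeR R) : R := expR (- y).

Let X01 y : 0 <= y -> 0 <= X y <= 1.
Proof. by move=> y0; rewrite expR_ge0/= expR_le1 oppr_le0. Qed.

Let bX : bm X.
Proof.
split; first by apply: (measurableT_comp (@measurable_expR R)); exact: oppr_measurable.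
exists 1 => y /X01 /andP[x0 x1]; by rewrite ger0_norm.
Qed.

Let bX1 : bm (fun y => 1 - X y).
Proof.
have := bounded_measurableD (bounded_measurable_cst 1)
  (bounded_measurableM (bounded_measurable_cst (-1)) bX).
by under eq_fun do rewrite mulN1r.
Qed.

Let delta f := \int[mu]_(y in H) f y - a * \int[nu]_(y in H) f y.

Let deltaD f g : bm f -> bm g -> delta (fun y => f y + g y) = delta f + delta g.
Proof.
move=> bf bg; rewrite /delta !RintegralD ?bounded_measurable_integrable//; ring.
Qed.

Let deltaZ (x : R) f : bm f -> delta (fun y => x * f y) = x * delta f.
Proof.
by move=> bf; rewrite /delta !RintegralZl ?bounded_measurable_integrable//; ring.
Qed.

Hypothesis hcm : forall n, cm n (fun k =>
  \int[mu]_(y in H) expR (- (k%:R * y)) - a * \int[nu]_(y in H) expR (- (k%:R * y))).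

(** By [hcm], the integrals of the powers [X^i] form a completely monotone sequence, and each
    backward difference in [i] produces a factor [1 - X]. Induction on [j] therefore needs complete
    monotonicity in [i] at all orders, not just positivity. *)
Let delta_monomial i j : 0 <= delta (fun y => X y ^+ i * (1 - X y) ^+ j).
Proof.
suff : forall n, cm n (fun i => delta (fun y => X y ^+ i * (1 - X y) ^+ j)).
  by move=> /(_ 0%N); exact.
elim: j => [|j IH] n.
  apply: eq_cm (hcm n) => k; rewrite /delta.
  suff E : (fun y : measurableTypeR R => expR (- (k%:R * y)))
           = (fun y => X y ^+ k * (1 - X y) ^+ 0) by rewrite E.
  by apply/funext => y; rewrite expr0 mulr1 /X -expRM_natl mulrN.
have [_] := IH n.+1; apply: eq_cm => k.
have bk i' j' : bm (fun y => X y ^+ i' * (1 - X y) ^+ j').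
  by apply: bounded_measurableM; exact: bounded_measurableX.
rewrite -[LHS]addrC -mulN1r -deltaZ// -deltaD//; last first.
  by apply: bounded_measurableM => //; exact: bounded_measurable_cst.
congr delta; apply/funext => y; rewrite !exprS; ring.
Qed.

Let bm_binomial_mean n (f : nat -> R) : bm (fun y => binomial_mean (X y) n f).
Proof.
elim: n f => [|n IH] f /=; first exact: bounded_measurable_cst.
by apply: bounded_measurableD; exact: bounded_measurableM.
Qed.

(** The weight [X^i * (1 - X)^j] of the trials already performed is carried along as a factor, so
    that unfolding the recursion ends in [delta_monomial]. *)
Let delta_binomial_mean n (f : nat -> R) : (forall i, 0 <= f i) ->
  0 <= delta (fun y => binomial_mean (X y) n f).
Proof.
move=> f0; suff : forall i j,
    0 <= delta (fun y => X y ^+ i * (1 - X y) ^+ j * binomial_mean (X y) n f).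
  move=> /(_ 0%N 0%N); congr (_ <= delta _).
  by apply/funext => y; rewrite !expr0 !mul1r.
have bk i j : bm (fun y => X y ^+ i * (1 - X y) ^+ j).
  by apply: bounded_measurableM; exact: bounded_measurableX.
elim: n f f0 => [|n IH] f f0 i j /=.
  under [X in delta X]eq_fun do rewrite mulrC.
  by rewrite deltaZ// mulr_ge0.
have -> : (fun y => X y ^+ i * (1 - X y) ^+ j *
      (X y * binomial_mean (X y) n (fun i => f i.+1)
       + (1 - X y) * binomial_mean (X y) n f))
  = (fun y => X y ^+ i.+1 * (1 - X y) ^+ j * binomial_mean (X y) n (fun i => f i.+1)
      + X y ^+ i * (1 - X y) ^+ j.+1 * binomial_mean (X y) n f).
  by apply/funext => y; rewrite !exprS; ring.
rewrite deltaD; [|exact: bounded_measurableM|exact: bounded_measurableM].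
by rewrite addr_ge0// IH.
Qed.

Let delta_cvg (g_ : nat -> measurableTypeR R -> R) g : (forall n, bm (g_ n)) -> bm g ->
  (forall n y, 0 <= y -> `|g_ n y| <= 1) ->
  (forall y, 0 <= y -> g_ n y @[n --> \oo] --> g y) ->
  delta (g_ n) @[n --> \oo] --> delta g.
Proof.
move=> bg_ bg g1 cvg_g.
have int_cvg (m : {measure set (measurableTypeR R) -> \bar R}) : m H = 1%E ->
    \int[m]_(y in H) g_ n y @[n --> \oo] --> \int[m]_(y in H) g y.
  move=> m1; have ig := bounded_measurable_integrable m1 bg.
  apply: fine_cvg; rewrite fineK; last exact: integrable_fin_num.
  apply: (dominated_cvg mH _ _ _
    (bounded_measurable_integrable m1 (bounded_measurable_cst 1))) => //.
  - by move=> n; apply/measurable_EFinP/measurable_funTS; case: (bg_ n).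
  - move=> y; rewrite /H /= in_itv/= andbT => y0.
    by apply: cvg_EFin; [exact: nearW | exact: cvg_g].
  - by move=> n y; rewrite /H /= in_itv/= andbT => y0; rewrite lee_fin g1.
apply: cvgB; first exact: int_cvg.
by apply: cvgMl_tmp; exact: int_cvg.
Qed.

(** The Bernstein polynomials of [g], evaluated at [X], have nonnegative [delta], take values in
    [[0, 1]] and converge pointwise to [g]; dominated convergence passes to the limit. *)
Let delta_lipschitz (g : R -> R) L : measurable_fun setT g -> 0 <= L ->
  (forall y z, `|g y - g z| <= L * `|y - z|) -> (forall x, 0 <= g x <= 1) ->
  0 <= delta (g \o X).
Proof.
move=> mg L0 lip g01.
pose g_ n (y : measurableTypeR R) :=
  binomial_mean (X y) n.+1 (fun i => g (i%:R / n.+1%:R)).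
have : delta (g_ n) @[n --> \oo] --> delta (g \o X).
  apply: delta_cvg => [n||n y y0|y y0].
  - exact: bm_binomial_mean.
  - split; first exact: (measurableT_comp mg bX.1).
    by exists 1 => y _; have /andP[? ?] := g01 (X y); rewrite ger0_norm.
  - have x01 := X01 y0.
    have lo : 0 <= g_ n y.
      rewrite -(binomial_mean_cst (X y) n.+1 0); apply: le_binomial_mean => // i.
      by case/andP: (g01 (i%:R / n.+1%:R)).
    rewrite ger0_norm// -(binomial_mean_cst (X y) n.+1 1).
    apply: le_binomial_mean => // i.
    by case/andP: (g01 (i%:R / n.+1%:R)).
  - exact: (binomial_mean_cvg (X01 y0) L0 lip).
move/cvgr_to_ge; apply; apply: nearW => n; apply: delta_binomial_mean => i.
by case/andP: (g01 (i%:R / n.+1%:R)).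
Qed.

Lemma hausdorff_itv_le (r s : R) :
  a * fine (nu (`]r, s] `&` H)) <= fine (mu (`]r, s] `&` H)).
Proof.
(* [X] is decreasing, so [y] lies in []r, s]] exactly when [p <= X y < q]. *)
pose p := expR (- s); pose q := expR (- r).
pose g j : R -> R := trapezoid p q j.
have mg j : measurable_fun setT (g j : measurableTypeR R -> R).
  have lin (x y : R) : measurable_fun setT (fun z : measurableTypeR R => x + y * z).
    by apply: measurable_funD => //; exact: mulrl_measurable.
  have -> : g j = (fun z => Num.max 0 (Num.min 1
      (Num.min ((1 - j%:R * p) + j%:R * z) (j%:R * q + - j%:R * z)))).
    apply/funext => z; rewrite /g /trapezoid; congr (Num.max _ (Num.min _ (Num.min _ _))).
      by ring.
    by ring.
  apply: measurable_maxr; first exact: measurable_cst.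
  apply: measurable_minr; first exact: measurable_cst.
  exact: measurable_minr.
have bg j : bm (g j \o X).
  split; first exact: (measurableT_comp (mg j) bX.1).
  by exists 1 => y _ /=; rewrite ger0_norm ?trapezoid_ge0 ?trapezoid_le1.
have mI : measurable (`]r, s]%classic : set (measurableTypeR R)).
  exact: measurable_itv.
have cv : delta (g j \o X) @[j --> \oo] --> delta (\1_(`]r, s]%classic)).
  apply: delta_cvg => // [|n y _|y y0].
  - split; first exact: measurable_indic.
    exists 1 => y _; rewrite indicE; case: (_ \in _); rewrite ?normr1 ?normr0//.
  - by rewrite /= ger0_norm ?trapezoid_ge0 ?trapezoid_le1.
  - have -> : \1_(`]r, s]%classic) y = (p <= X y < q)%R%:R :> R.
      rewrite indicE /p /q /X ler_expR ltr_expR lerN2 ltrN2 andbC.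
      by congr (_%:R); congr nat_of_bool; apply/idP/idP; rewrite inE/= in_itv/=.
    exact: trapezoid_cvg.
have : 0 <= delta (\1_(`]r, s]%classic)).
  apply: (cvgr_to_ge cv); apply: nearW => j.
  apply: (@delta_lipschitz (g j) j%:R) => //; [exact: mg | exact: trapezoid_lipschitz |].
  by move=> x; rewrite trapezoid_ge0 trapezoid_le1.
rewrite /delta subr_ge0 /Rintegral.
by rewrite !integral_indic.
Qed.

End hausdorff_positivity.

(** * From domination on intervals to domination on Borel sets *)

Section domination.
Context {R : realType}.

(** The identity as a random variable: its [cdf] under [P] is the distribution function of [P],
    known to be right-continuous. *)
Let idTR : measurableTypeR R -> R := idfun.

#[local] HB.instance Definition _ :=
  @isMeasurableFun.Build _ _ _ _ idTR (@measurable_id _ _ setT).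

Lemma distribution_function_right_continuous
    (P : probability (measurableTypeR R) R) :
  right_continuous (fun r : R => fine (P `]-oo, r]%classic)).
Proof.
move=> r; apply: fine_cvg; rewrite fineK ?fin_num_measure//.
exact: (@cdf_right_continuous _ _ _ P (idTR : {RV P >-> R})).
Qed.

Let fine_itv_oc (P : probability (measurableTypeR R) R) (r s : R) : r <= s ->
  fine (P `]r, s]%classic) = fine (P `]-oo, s]%classic) - fine (P `]-oo, r]%classic).
Proof.
move=> rs; have -> : `]r, s]%classic = `]-oo, s]%classic `\` `]-oo, r]%classic.
  by rewrite -[RHS]setCK setCD setCitvl setUC -[LHS]setCK setCitv.
rewrite measureD ?setIidr//; last by rewrite -ge0_fin_numE ?fin_num_measure.
  by rewrite fineB ?fin_num_measure.
exact: subset_itvl.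
Qed.

Lemma lebesgue_stieltjes_itv (f : cumulative R R) (r s : R) : r <= s ->
  lebesgue_stieltjes_measure f `]r, s]%classic = (f s - f r)%:E.
Proof.
move=> rs; rewrite /lebesgue_stieltjes_measure /measure_extension/=.
by rewrite measurable_mu_extE/=; [rewrite wlength_itv_bnd | exact: is_ocitv].
Qed.

(** The measure [rho] realizes [mu - a * nu]: the difference [F] of the distribution functions is
    nondecreasing by hypothesis and right-continuous, hence has a Lebesgue-Stieltjes measure. Both
    sides agree on the intervals []r, s]], which are stable under intersection and generate the
    Borel sets. *)
Lemma probability_domination (mu nu : probability (measurableTypeR R) R) (a : R) :
  0 <= a ->
  (forall r s : R, a * fine (nu `]r, s]%classic) <= fine (mu `]r, s]%classic)) ->
  exists rho : {measure set (measurableTypeR R) -> \bar R},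
    forall A, measurable A -> mu A = (rho A + a%:E * nu A)%E.
Proof.
move=> a0 h.
pose F (r : R) : R := fine (mu `]-oo, r]%classic) - a * fine (nu `]-oo, r]%classic).
have FB r s : r <= s -> F s - F r = fine (mu `]r, s]%classic) - a * fine (nu `]r, s]%classic).
  by move=> rs; rewrite !fine_itv_oc// /F; ring.
have Fnd : nondecreasing F.
  by move=> r s rs; rewrite -subr_ge0 FB// subr_ge0.
have Frc : right_continuous F.
  move=> r; apply: cvgB; first exact: distribution_function_right_continuous.
  by apply: cvgMl_tmp; exact: distribution_function_right_continuous.
have [Fc FcE] : exists Fc : cumulative R R, forall r, Fc r = F r.
  pose Fc : cumulative R R := HB.pack F (isCumulative.Build R _ R F Fnd Frc).
  by exists Fc.
pose rho : {measure set (measurableTypeR R) -> \bar R} := lebesgue_stieltjes_measure Fc.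
pose m1 : {measure set (measurableTypeR R) -> \bar R} :=
  measure_add rho (mscale (NngNum a0) nu).
have m1E B : m1 B = (rho B + a%:E * nu B)%E by exact: measure_addE.
exists rho => A mA; rewrite -m1E.
pose g k : set (measurableTypeR R) := `]- k%:R, k%:R]%classic.
have cover : \bigcup_k g k = setT.
  apply/seteqP; split=> // x _; exists (Num.bound `|x|) => //=.
  have := archi_boundP (normr_ge0 x); rewrite /g /= in_itv/= ltr_norml.
  by move=> /andP[-> /ltW].
have eqG I : ocitv I -> mu I = m1 I.
  move=> [[r s] _ <-] /=; rewrite m1E.
  have [rs|sr] := leP r s; last first.
    by rewrite set_itv_ge ?measure0 ?mule0 ?adde0// bnd_simp -leNgt ltW.
  rewrite [rho _](lebesgue_stieltjes_itv Fc rs) !FcE FB//.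
  rewrite -[LHS]fineK ?fin_num_measure//.
  rewrite -[X in (_ = _ + _ * X)%E]fineK ?fin_num_measure//.
  by rewrite -EFinM -EFinD subrK.
have fing k : (mu (g k) < +oo)%E.
  by apply: le_lt_trans (ltry 1); apply: probability_le1; exact: measurable_itv.
have mE : @measurable _ (measurableTypeR R) = <<s @ocitv R >> by [].
apply: (@measure_unique _ R (measurableTypeR R) (@ocitv R) g mE (@ocitvI R)
  (fun k => is_ocitv _ _) cover mu m1 eqG fing).
exact: mA.
Qed.

End domination.

(** * Total variation bound from domination *)

Section total_variation.
Context {R : realType}.
Let H : set (measurableTypeR R) := `[0, +oo[%classic.

Let mH : measurable H. Proof. exact: measurable_itv. Qed.

Lemma var_norm_subC (mu nu : {measure set (measurableTypeR R) -> \bar R}) :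
  var_norm_sub mu nu = var_norm_sub nu mu.
Proof.
rewrite /var_norm_sub; congr ereal_sup; apply/seteqP.
by split=> _ [f hf <-]; exists f => //; rewrite distrC.
Qed.

Section dominated.
Variables (mu nu : {measure set (measurableTypeR R) -> \bar R}) (a : R).
Hypotheses (muH : mu H = 1%E) (nuH : nu H = 1%E) (a0 : 0 <= a)
  (numu : forall r s : R,
    a * fine (nu (`]r, s] `&` H)) <= fine (mu (`]r, s] `&` H))).

(** Only the masses on [H] are prescribed; restricting to [H] yields probability measures on the
    whole line, to which [probability_domination] applies. *)
Lemma dominated_measure : exists rho : {measure set (measurableTypeR R) -> \bar R},
  forall A, measurable A -> A `<=` H -> mu A = (rho A + a%:E * nu A)%E.
Proof.
have mass (m : {measure set (measurableTypeR R) -> \bar R}) : m H = 1%E ->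
    mrestr m mH setT = 1%E by rewrite /mrestr setTI.
pose mu' : probability (measurableTypeR R) R := HB.pack (mrestr mu mH)
  (Measure_isProbability.Build _ _ _ (mrestr mu mH) (mass _ muH)).
pose nu' : probability (measurableTypeR R) R := HB.pack (mrestr nu mH)
  (Measure_isProbability.Build _ _ _ (mrestr nu mH) (mass _ nuH)).
have [rho hrho] := @probability_domination R mu' nu' a a0 numu.
exists rho => A mA AH; have := hrho A mA.
by rewrite /mu' /nu' /= /mrestr (setIidl AH).
Qed.

Lemma dominated_Rintegral (g : measurableTypeR R -> R) :
  nu.-integrable H (EFin \o g) -> mu.-integrable H (EFin \o g) ->
  (forall u, H u -> 0 <= g u) ->
  a * \int[nu]_(u in H) g u <= \int[mu]_(u in H) g u.
Proof.
move=> ig ig' g0; have [rho hrho] := dominated_measure.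
have mg := measurable_int _ ig.
have ge0 u : H u -> (0 <= (EFin \o g) u)%E by move=> /g0; rewrite /= lee_fin.
have E : (\int[mu]_(u in H) (g u)%:E =
    \int[rho]_(u in H) (g u)%:E + a%:E * \int[nu]_(u in H) (g u)%:E)%E.
  rewrite (@eq_measure_integral _ _ _ H (measure_add rho (mscale (NngNum a0) nu))).
    by rewrite ge0_integral_measure_add// ge0_integral_mscale.
  by move=> A mA AH; rewrite hrho//; apply/esym; exact: measure_addE.
have fn := integrable_fin_num mH ig; have fm := integrable_fin_num mH ig'.
rewrite -lee_fin /Rintegral EFinM !fineK// E leeDr//.
exact: integral_ge0.
Qed.

(** Let [I] and [J] be the integrals of [f] against [nu] and [mu]. Domination applied to the
    nonnegative functions [1 + f] and [1 - f] gives [|J - a * I| <= 1 - a]; adding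
    [(1 - a) * |I| <= 1 - a] yields the constant 2. *)
Lemma var_norm_sub_dominated : (var_norm_sub mu nu <= (2 * (1 - a))%:E)%E.
Proof.
apply: ge_ereal_sup => _ [f [mf f1] <-]; rewrite lee_fin.
have H0 u : H u -> 0 <= u by rewrite /H /= in_itv/= andbT.
have int (m : {measure set (measurableTypeR R) -> \bar R}) : m H = 1%E ->
    m.-integrable H (EFin \o f) /\ m.-integrable H (EFin \o cst (1 : R)).
  move=> m1; have my : (m H < +oo)%E by rewrite m1 ltry.
  split; apply: measurable_bounded_integrable => //.
    by exists 1; split=> [|M M1 u /H0 u0]; 
      [exact: num_real | exact: le_trans (f1 _ u0) (ltW M1)].
  by exists 1; split=> [|M M1 u _ /=]; [exact: num_real | rewrite normr1 ltW].
have one (m : {measure set (measurableTypeR R) -> \bar R}) : m H = 1%E ->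
    \int[m]_(u in H) cst (1 : R) u = 1 by move=> m1; rewrite Rintegral_cst// m1 mulr1.
have [imf im1] := int _ muH; have [inf in1] := int _ nuH.
have fb u : H u -> - 1 <= f u <= 1 by move=> /H0 /f1; rewrite ler_norml.
have p1 : a * \int[nu]_(u in H) (cst 1 u + f u) <= \int[mu]_(u in H) (cst 1 u + f u).
  apply: dominated_Rintegral.
  - by apply: eq_integrable (integrableD mH in1 inf).
  - by apply: eq_integrable (integrableD mH im1 imf).
  - by move=> u /fb /andP[? ?] /=; lra.
have p2 : a * \int[nu]_(u in H) (cst 1 u - f u) <= \int[mu]_(u in H) (cst 1 u - f u).
  apply: dominated_Rintegral.
  - by apply: eq_integrable (integrableB mH in1 inf).
  - by apply: eq_integrable (integrableB mH im1 imf).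
  - by move=> u /fb /andP[? ?] /=; lra.
have n1 : - 1 <= \int[nu]_(u in H) f u <= 1.
  rewrite -ler_norml -(one nu nuH); apply: (le_trans (le_normr_Rintegral mH inf)).
  apply: le_Rintegral => //; first exact: integrable_norm inf.
  by move=> u /H0 /f1.
rewrite !RintegralD// !one// in p1; rewrite !RintegralB// !one// in p2.
move: n1 p1 p2; rewrite -/H.
move: (Rintegral nu H f) (Rintegral mu H f) => I J /andP[I1 I2] p1 p2.
rewrite ler_norml; apply/andP; split; nra.
Qed.

End dominated.
End total_variation.

(** * Comparison of the transition laws from two starting points *)

Section cbi.
Context {R : realType} (b c : R) (m : {measure set (measurableTypeR R) -> \bar R}).
Hypotheses (hc : 0 <= c)
  (hm : (\int[m]_(u in `]0%R, +oo[) (Num.min u (u ^+ 2))%:E < +oo)%E).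
Variable v : R -> R -> R.
Hypothesis hv : forall lambda : R, 0 <= lambda ->
  cumulant_solution (branching_mechanism b c m) lambda (v ^~ lambda).
Variable theta : R.
Hypotheses (htheta : 0 < theta)
  (hphi_pos : forall z : R, theta <= z -> 0 < branching_mechanism b c m z)
  (hphi_int : (\int[@lebesgue_measure R]_(z in `[theta, +oo[)
                 ((branching_mechanism b c m z)^-1)%:E < +oo)%E).
Variable t : R.
Hypothesis t0 : 0 < t.

(** At order 0 this is the bound of [v] by its limit. In the differences [vbar v t] cancels, leaving
    the increments of the Bernstein sequence [v t k%:R]. *)
Lemma vbar_sub_cm n : cm n (fun k => vbar v t - v t k%:R).
Proof.
have bv : bernstein (fun k => v t k%:R).
  have := cumulant_bernstein hc hm hv (ltW t0) (lexx 0) ler01.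
  by apply: eq_bernstein => k; rewrite add0r mul1r.
elim: n => [k|n IH].
  rewrite subr_ge0; exact: (cumulant_le_vbar hc hm htheta hphi_pos hphi_int).
by split=> //; apply: eq_cm (bv.2 n) => k; ring.
Qed.

Lemma vbar_ge0 : 0 <= vbar v t.
Proof.
have := cm_ge0 (vbar_sub_cm 0) 0; rewrite subr_ge0; apply: le_trans.
by have := cumulant_ge0 (hv (lexx 0)) (ltW t0).
Qed.

Lemma cbi_var_norm_le (psi : R -> R)
    (P : R -> R.-pker (measurableTypeR R) ~> (measurableTypeR R)) (x y : R) :
  cbi_transition_semigroup psi v P -> 0 <= y -> y <= x ->
  (var_norm_sub (P t x) (P t y)
     <= (2 * (1 - expR (- (vbar v t * (x - y)))))%:E)%E.
Proof.
move=> [sP LP] y0 yx; have x0 := le_trans y0 yx.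
have xy0 : 0 <= x - y by rewrite subr_ge0.
have Px : P t x `[0, +oo[%classic = 1%E by apply: semigroup_state_space => //; exact: ltW.
have Py : P t y `[0, +oo[%classic = 1%E by apply: semigroup_state_space => //; exact: ltW.
set a := expR _.
apply: var_norm_sub_dominated => //; first exact: expR_ge0.
move=> r s; apply: hausdorff_itv_le => // n.
have cmL : cm n (fun k => \int[P t y]_(u in `[0, +oo[) expR (- (k%:R * u))).
  apply: cm_Rintegral => [|k|u]; first exact: measurable_itv.
    apply: bounded_measurable_integrable => //; split.
      apply: (measurableT_comp (@measurable_expR R)).
      by apply: measurable_funN; exact: mulrl_measurable.
    exists 1 => u u0; rewrite ger0_norm ?expR_ge0// expR_le1 oppr_le0.
    exact: mulr_ge0.
  rewrite /= in_itv/= andbT => u0.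
  apply: eq_cm (cm_expRN_bernstein n u0 (bernstein_affine (lexx 0) ler01)) => k.
  by rewrite add0r mul1r mulrC.
(* The immigration factor is common to both Laplace transforms, so it stays inside the one started
   from [y]; what remains is [a * (expR ((x - y) * (vbar v t - v t k%:R)) - 1)]. *)
apply: eq_cm (cmM cmL (cmZ (expR_ge0 (- (vbar v t * (x - y))))
  (cm_expR_sub1 (cmZ xy0 (vbar_sub_cm n))))) => k.
rewrite !LP ?(ltW t0)// -/a.
rewrite mulrBr mulr1 mulrBr -expRD; congr (_ - _); last by rewrite mulrC.
by rewrite /a -expRD; congr expR; ring.
Qed.

End cbi.

Theorem theorem10p3 (R : realType)
  (b c : R) (m : {measure set (measurableTypeR R) -> \bar R})
  (hc : 0 <= c)
  (hm_sigma : sigma_finite (`]0, +oo[%classic : set (measurableTypeR R)) m)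
  (hm : (\int[m]_(u in `]0%R, +oo[) (Num.min u (u ^+ 2))%:E < +oo)%E)
  (beta : R) (nu : {measure set (measurableTypeR R) -> \bar R})
  (hbeta : 0 <= beta)
  (hnu_sigma : sigma_finite (`]0, +oo[%classic : set (measurableTypeR R)) nu)
  (hnu : (\int[nu]_(u in `]0%R, +oo[) (Num.min 1 u)%:E < +oo)%E)
  (hnu1 : (\int[nu]_(u in `]0%R, +oo[) u%:E < +oo)%E)
  (v : R -> R -> R)
  (hv : forall lambda : R, 0 <= lambda ->
    cumulant_solution (branching_mechanism b c m) lambda (v ^~ lambda))
  (P : R -> R.-pker (measurableTypeR R) ~> (measurableTypeR R))
  (hP : cbi_transition_semigroup (immigration_mechanism beta nu) v P)
  (theta : R) (htheta : 0 < theta)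
  (hphi_pos : forall z : R, theta <= z -> 0 < branching_mechanism b c m z)
  (hphi_int : (\int[@lebesgue_measure R]_(z in `[theta, +oo[)
                 ((branching_mechanism b c m z)^-1)%:E < +oo)%E)
  (t : R) (ht : 0 < t) (x y : R) (hx : 0 <= x) (hy : 0 <= y) :
  (var_norm_sub (P t x) (P t y)
     <= (2 * (1 - expR (- (vbar v t * `|x - y|))))%:E)%E /\
  2 * (1 - expR (- (vbar v t * `|x - y|))) <= 2 * vbar v t * `|x - y|.
Proof.
have V0 : 0 <= vbar v t by apply: (vbar_ge0 hc hm hv htheta hphi_pos hphi_int ht).
have le2 := cbi_var_norm_le hc hm hv htheta hphi_pos hphi_int ht hP.
split.
  case: (leP y x) => [yx|/ltW xy].
    by rewrite ger0_norm ?subr_ge0//; exact: le2.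
  by rewrite distrC ger0_norm ?subr_ge0// var_norm_subC; exact: le2.
(* The second bound is [1 - z <= expR (- z)] at [z = vbar v t * |x - y|]. *)
rewrite -mulrA ler_pM2l// lerBlDl -lerBlDr.
by apply: le_trans (expR_ge1Dx _); rewrite addrC.
Qed.
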